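(* Let $T>0$ and let $f\colon[0,T]\times\mathbb{R}^n\to\mathbb{R}$ be a $C^3$ function such that, for some $a_0\ge0$ and $c_0>0$, $\nabla_x f(t,x)\cdot x\ge c_0|x|^2-a_0$ for all $(t,x)\in[0,T]\times\mathbb{R}^n$. Suppose that for every $(\tau,\xi)\in Z_f$ such that $\nabla_x^2 f(\tau,\xi)$ is positive semidefinite there exists $\ell\in\mathbb{R}^n\setminus\{0\}$ such that (a) $\ker\nabla_x^2 f(\tau,\xi)=\mathrm{span}(\ell)$; (c) $\sum_{i,j,k}f_{x_ix_jx_k}(\tau,\xi)\,\ell_i\ell_j\ell_k\neq0$. Let $(\tau,\xi)\in Z_f$ be such that $\nabla_x^2 f(\tau,\xi)$ is positive semidefinite. Then there exists a unique (up to time-translations) nonconstant solution $w\colon\mathbb{R}\to\mathbb{R}^n$ of the problem $$\dot w(s)=-\nabla_x f(\tau,w(s)),\qquad \lim_{s\to-\infty}w(s)=\xi.$$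
   Context: $\nabla_x f$ and $\nabla_x^2 f$ denote the gradient and the Hessian of $f$ with respect to $x\in\mathbb{R}^n$, and $Z_f:=\{(t,\xi)\in[0,T]\times\mathbb{R}^n:\ \nabla_x f(t,\xi)=0,\ \det\nabla_x^2 f(t,\xi)=0\}$. Uniqueness up to time-translations means that any two such solutions $w,\tilde w$ satisfy $\tilde w(s)=w(s+c)$ for all $s$, for some $c\in\mathbb{R}$. *)

(* Defs.v *)
From HB Require Import structures.
From mathcomp Require Import all_boot all_order all_algebra.
From mathcomp Require Import all_classical all_reals all_analysis.

Set Implicit Arguments.
Unset Strict Implicit.
Unset Printing Implicit Defensive.

Import Order.TTheory GRing.Theory Num.Theory.
Import numFieldNormedType.Exports.

Local Open Scope classical_set_scope.
Local Open Scope ring_scope.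

(** Points of R^n are row vectors.  The library norm on ['rV[R]_n] is the sup
    norm, so the Euclidean scalar product is spelled out; |x|^2 is [dot x x]. *)
Definition dot (R : realType) (n : nat) (u v : 'rV[R]_n) : R :=
  \sum_(i < n) u ord0 i * v ord0 i.

Definition partial (R : realType) (n : nat) (i : 'I_n) (g : 'rV[R]_n -> R) :
    'rV[R]_n -> R :=
  fun x => 'D_(delta_mx ord0 i) g x.

Definition grad (R : realType) (n : nat) (g : 'rV[R]_n -> R)
    (x : 'rV[R]_n) : 'rV[R]_n :=
  \row_i partial i g x.

Definition hessian (R : realType) (n : nat) (g : 'rV[R]_n -> R)
    (x : 'rV[R]_n) : 'M[R]_n :=
  \matrix_(i, j) partial j (partial i g) x.

Definition third_form (R : realType) (n : nat) (g : 'rV[R]_n -> R)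
    (x l : 'rV[R]_n) : R :=
  \sum_(i < n) \sum_(j < n) \sum_(k < n)
    partial k (partial j (partial i g)) x
    * l ord0 i * l ord0 j * l ord0 k.

Definition possemidef (R : realType) (n : nat) (A : 'M[R]_n) : Prop :=
  forall v : 'rV[R]_n, 0 <= dot v (v *m A^T).

(** Functions on [0,T] x R^n are represented by total functions of (t,x) whose
    values for t outside [0,T] are never used.  At t = 0 and t = T the time
    derivative is one-sided: it is the limit of the difference quotient as s
    tends to t within [0,T] \ {t}. *)
Definition is_dt (R : realType) (n : nat) (T : R)
    (g gt : R -> 'rV[R]_n -> R) : Prop :=
  forall (t : R) (x : 'rV[R]_n), t \in `[0, T] ->
    (s - t)^-1 * (g s x - g t x)
      @[s --> within (fun s : R => s \in `[0, T]) t^'] --> gt t x.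

(** [CkT T k g]: g is of class C^k on [0,T] x R^n, i.e. all its partial
    derivatives (in t and in x, in any order) of order at most k exist and are
    continuous on [0,T] x R^n, up to the boundary. *)
Fixpoint CkT (R : realType) (n : nat) (T : R) (k : nat)
    (g : R -> 'rV[R]_n -> R) : Prop :=
  {within `[0, T] `*` [set: 'rV[R]_n],
     continuous (fun p : R * 'rV[R]_n => g p.1 p.2)} /\
  match k with
  | 0 => True
  | k'.+1 =>
      (exists gt, is_dt T g gt /\ CkT T k' gt) /\
      (forall i : 'I_n,
         (forall (t : R) x, t \in `[0, T] -> derivable (g t) x (delta_mx ord0 i)) /\
         CkT T k' (fun t => partial i (g t)))
  end.

Definition Zset (R : realType) (n : nat) (T : R) (f : R -> 'rV[R]_n -> R) :
    set (R * 'rV[R]_n) :=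
  [set p | [/\ p.1 \in `[0, T], grad (f p.1) p.2 = 0
             & \det (hessian (f p.1) p.2) = 0]].

Definition nonconstant_orbit_from (R : realType) (n : nat)
    (g : 'rV[R]_n -> R) (xi : 'rV[R]_n) (w : R -> 'rV[R]_n) : Prop :=
  [/\ forall s : R, is_derive s (1 : R) w (- grad g (w s)),
      w s @[s --> -oo%R] --> xi
    & ~ (exists c, forall s, w s = c)].

(* Main.v *)
Require Import Defs.
From HB Require Import structures.
From mathcomp Require Import all_boot all_order all_algebra.
From mathcomp Require Import all_classical all_reals all_analysis.
From mathcomp Require Import ring lra.
Import Order.TTheory GRing.Theory Num.Theory.
Import numFieldNormedType.Exports.
Local Open Scope classical_set_scope.
Local Open Scope ring_scope.

(** The stationary point [xi] has a one-dimensional critical direction [l] and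
    is nondegenerate transversally to it.  Two solutions [a], [b] of
    w' = - grad g (w) that stay near [xi] as s -> -oo are compared through the
    quadratic form V d = |d|^2 - (1 + theta^2) (d.l)^2 of their difference
    d = a - b: where V is positive it decays along the flow at a rate
    proportional to V, because the Hessian is coercive transversally to [l];
    hence it would blow up backward in time, so V <= 0 for all s near -oo.
    With b = xi, every orbit emanating from [xi] lies in a narrow cone around
    the line xi + R l, in which the third-order term makes u = (w - xi).l
    increase at least like u^2, so u > 0.  After a time shift, two orbits have
    the same coordinate u at some time; then V <= 0 forces them to coincide.

    For existence, start solutions at xi + eps l with eps -> 0 and stop them
    when they leave a small ball around [xi].  The exit times tend to infinity
    (Gronwall), and the solution through a cluster point of the exit points
    stays in the cone backward in time, where u must tend to 0.  It is global
    forward in time by coercivity. *)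

Set Implicit Arguments.
Unset Strict Implicit.

(** * One-variable calculus *)

Section RealCalculus.
Context {R : realType}.
Implicit Types (N dN h : R -> R) (a b c e s t : R).

(** The linearisation at [xi] has a zero eigenvalue, so exponential rates do not produce the orbit,
    and quadratic forms take the place of a centre-manifold reduction. Up to a small error the
    derivative of V along a difference d is - 2 d.Sd, with S the Hessian at [xi]: the term in (d.l)
    l drops out because S is symmetric and S l = 0. Since the kernel of S is only the line of l,
    d.Sd is at least a multiple of |d|^2 - (d.l)^2, and this is at least a multiple of |d|^2 where V
    >= 0. The sign of l is chosen so that the cubic form is negative. Then u increases on both
    sides: away from 0 where u > 0, towards 0 where u < 0, so only one half of the cone can emit an
    orbit. The constants are chosen in a definite order: the cubic term decides how narrow the cone
    must be, and the resulting theta decides in how small a ball the Hessian must be close to S.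
    Solutions are constructed for globally Lipschitz fields, so the gradient is first truncated
    outside a large ball; coercivity keeps the orbit where the truncation changes nothing. *)

Lemma is_derive_continuous (V : normedModType R) (w : R -> V) (dw : V) t :
  is_derive t 1 w dw -> {for t, continuous w}.
Proof. by move=> [? _]; apply/differentiable_continuous/derivable1_diffP. Qed.

Lemma is_derive_shiftr (V : normedModType R) (w : R -> V) (dw : V) c t :
  is_derive (t + c) 1 w dw -> is_derive t 1 (fun s => w (s + c)) dw.
Proof.
move=> [dfw <-].
have E : (fun h : R => h^-1 *: ((fun s => w (s + c)) (h *: 1 + t) - w (t + c)))
       = (fun h : R => h^-1 *: (w (h *: 1 + (t + c)) - w (t + c))).
  by apply/funext => h; rewrite addrA.
by split; rewrite /derivable /derive /= E.
Qed.

Lemma is_derive_mulr N h t (a b : R) :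
  is_derive t 1 N a -> is_derive t 1 h b ->
  is_derive t 1 (fun s => N s * h s) (N t * b + h t * a).
Proof. by move=> dN_ dh; have := is_deriveM dN_ dh. Qed.

Lemma is_derive_expR_linear k t :
  is_derive t 1 (fun s => expR (k * s)) (k * expR (k * t)).
Proof.
have dk : is_derive t 1 (fun s : R => k * s) k.
  have := is_derive_mulr (is_derive_cst k t 1) (is_derive_id t 1).
  by move=> h; apply: (is_derive_eq h); rewrite mulr1 mulr0 addr0.
have := is_derive1_comp (is_derive_expR (k * t)) dk.
by move=> h; apply: (is_derive_eq h); rewrite mulrC.
Qed.

Lemma MVT_is_derive_oo N dN a b : a < b ->
  (forall t, t \in `[a, b] -> is_derive t 1 N (dN t)) ->
  exists2 c, c \in `]a, b[ & N b - N a = dN c * (b - a).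
Proof.
move=> ab dN_.
have H1 t : t \in `]a, b[ -> is_derive t 1 N (dN t).
  by move=> tab; apply: dN_; exact: (subset_itv_oo_cc tab).
apply: (MVT ab H1).
apply: derivable_within_continuous => t tab.
by have [] := dN_ t tab.
Qed.

Lemma MVT_is_derive N dN a b : a <= b ->
  (forall t, t \in `[a, b] -> is_derive t 1 N (dN t)) ->
  exists2 c, c \in `[a, b] & N b - N a = dN c * (b - a).
Proof.
move=> ab dN_.
have H1 t : t \in `]a, b[ -> is_derive t 1 N (dN t).
  by move=> tab; apply: dN_; exact: (subset_itv_oo_cc tab).
apply: (MVT_segment ab H1).
apply: derivable_within_continuous => t tab.
by have [] := dN_ t tab.
Qed.

Lemma nondecreasing_is_derive N dN a b : a <= b ->
  (forall t, t \in `[a, b] -> is_derive t 1 N (dN t)) ->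
  (forall t, t \in `[a, b] -> 0 <= dN t) -> N a <= N b.
Proof.
move=> ab dN_ dN0; have [c cab E] := MVT_is_derive ab dN_.
by rewrite -subr_ge0 E mulr_ge0 ?dN0// subr_ge0.
Qed.

Lemma nonincreasing_is_derive N dN a b : a <= b ->
  (forall t, t \in `[a, b] -> is_derive t 1 N (dN t)) ->
  (forall t, t \in `[a, b] -> dN t <= 0) -> N b <= N a.
Proof.
move=> ab dN_ dN0; have [c cab E] := MVT_is_derive ab dN_.
by rewrite -subr_le0 E mulr_le0_ge0 ?dN0// subr_ge0.
Qed.

(** Just after the last time with [N <= 0], [N] is positive but still below [e], so it cannot rise
    there. Testing only the strip [0 < N < e] lets the lemma be used when the sign of [dN] is known
    only near the boundary of a region. *)
Lemma barrier N dN a b e : 0 < e ->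
  (forall t, t \in `[a, b] -> is_derive t 1 N (dN t)) ->
  N a <= 0 ->
  (forall t, t \in `[a, b] -> 0 < N t < e -> dN t <= 0) ->
  forall t, t \in `[a, b] -> N t <= 0.
Proof.
move=> e0 dN_ Na0 H t1 /[1!in_itv]/= /andP[at1 t1b].
rewrite leNgt; apply/negP => Nt1.
pose S := [set t | [/\ a <= t, t <= t1 & N t <= 0]].
have Sa : S a by split.
have hS : has_sup S by split; [exists a | exists t1 => x []].
set s := sup S.
have as_ : a <= s by apply: ub_le_sup => //; exact: hS.2.
have st1 : s <= t1 by apply: ge_sup; [exists a | move=> x []].
have Nc t : a <= t -> t <= t1 -> {for t, continuous N}.
  move=> at_ tt1; apply: (@is_derive_continuous _ N (dN t) t).
  by apply: dN_; rewrite in_itv/= at_ (le_trans tt1).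
have after t : s < t -> t <= t1 -> 0 < N t.
  move=> st tt1; rewrite ltNge; apply/negP => Nt.
  have : t <= s.
    by apply: ub_le_sup; [exact: hS.2 | split=> //; exact: (le_trans as_ (ltW st))].
  by rewrite leNgt st.
have Ns : N s <= 0.
  rewrite leNgt; apply/negP => Ns0.
  have /cvgrPdist_lt /(_ _ Ns0) /nbhs_ballP[d d0 Hd] := Nc _ as_ st1.
  have [x Sx xs] := sup_adherent d0 hS.
  have xles : x <= s by apply: ub_le_sup => //; exact: hS.2.
  have /= := Hd x; rewrite /ball/= ger0_norm ?subr_ge0//.
  rewrite -/s in xs; move=> /(_ ltac:(lra)).
  case: Sx => _ _ Nx.
  rewrite ger0_norm; last by lra.
  by lra.
have sltt1 : s < t1.
  by rewrite lt_neqAle st1 andbT; apply/eqP => E; move: Ns; rewrite E leNgt Nt1.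
have /cvgrPdist_lt /(_ _ e0) /nbhs_ballP[d d0 Hd] := Nc _ as_ st1.
pose u := Num.min (s + d / 2) t1.
have d0' : 0 < d by [].
have su : s < u by rewrite lt_min sltt1 andbT; lra.
have ut1 : u <= t1 by rewrite ge_min lexx orbT.
have usd : u < s + d.
  by rewrite gt_min; apply/orP; left; lra.
have H2 x : x \in `[s, u] -> is_derive x 1 N (dN x).
  move=> xsu.
  apply: dN_.
  move: xsu; rewrite !in_itv/=.
  move=> /andP[sx xu].
  by apply/andP; split; lra.
have [c csu E] := MVT_is_derive_oo su H2.
move: csu; rewrite in_itv/= => /andP[sc cu].
have Nc0 : 0 < N c by apply: after => //; lra.
have Nce : N c < e.
  have /= := Hd c; rewrite /ball/= ltr0_norm ?subr_lt0// => /(_ ltac:(lra)).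
  rewrite distrC => /(le_lt_trans (ler_norm _)); lra.
have : dN c <= 0.
  apply: H; last by rewrite Nc0.
  by rewrite in_itv/=; apply/andP; split; lra.
move=> dNc.
have : N u - N s <= 0 by rewrite E mulr_le0_ge0//; lra.
have := after _ su ut1.
lra.
Qed.

Lemma first_hitting N c t1 : continuous N -> 0 <= t1 -> N 0 < c -> c <= N t1 ->
  exists2 t, 0 <= t & N t = c /\ forall s, 0 <= s -> s <= t -> N s <= c.
Proof.
move=> cN t10 N0 Nt1.
pose S := [set t | 0 <= t /\ c <= N t].
have hS : has_inf S by split; [exists t1 | exists 0 => x []].
have S0 : lbound S 0 by move=> x [].
set T := inf S.
have T0 : 0 <= T by apply: lb_le_inf => //; exact: hS.1.
have before s : 0 <= s -> s < T -> N s < c.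
  move=> s0 sT; rewrite ltNge; apply/negP => cs.
  by have := ge_inf hS.2 (conj s0 cs : S s); rewrite leNgt sT.
have cT : c <= N T.
  rewrite leNgt; apply/negP => NTc.
  have cNT0 : 0 < c - N T by rewrite subr_gt0.
  have /cvgrPdist_lt /(_ _ cNT0) /nbhs_ballP[d d0 Hd] := cN T.
  have [x Sx xT] := inf_adherent d0 hS.
  have Tx : T <= x by apply: ge_inf => //; exact: hS.2.
  have /= := Hd x; rewrite /ball/= distrC ger0_norm ?subr_ge0//.
  rewrite -/T in xT; move=> /(_ ltac:(lra)).
  case: Sx => _ Nx; have := ler_norm (- (N T - N x)); rewrite normrN; lra.
have Tc : N T <= c.
  rewrite leNgt; apply/negP => NTc.
  have Tp : 0 < T.
    by rewrite lt_neqAle T0 andbT; apply/eqP => E; move: NTc; rewrite -E ltNge ltW.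
  have cNT0 : 0 < N T - c by rewrite subr_gt0.
  have /cvgrPdist_lt /(_ _ cNT0) /nbhs_ballP[d d0 Hd] := cN T.
  have {}d0 : 0 < d by [].
  pose s := T - Num.min d T / 2.
  have mp : 0 < Num.min d T by rewrite lt_min d0.
  have md : Num.min d T <= d by rewrite ge_min lexx.
  have mT : Num.min d T <= T by rewrite ge_min lexx orbT.
  have /= := Hd s; rewrite /ball/= /s opprD addrA subrr add0r opprK ger0_norm;
    last by lra.
  move=> /(_ ltac:(lra)); rewrite -/s.
  have s0 : 0 <= s by rewrite /s; lra.
  have sT : s < T by rewrite /s; lra.
  have := before s s0 sT; have := ler_norm (N T - N s); lra.
exists T => //; split; first by apply/eqP; rewrite eq_le Tc cT.
move=> s s0; rewrite le_eqVlt => /orP[/eqP ->//|sT]; exact/ltW/before.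
Qed.

(** The two-sided bound on [dN] makes N exp(-K t) nonincreasing and N exp(K t) nondecreasing, so the
    estimate runs in both directions of time; the backward one is needed to compare orbits at
    negative times. *)
Lemma gronwall N dN a b K : 0 <= K ->
  (forall t, t \in `[a, b] -> is_derive t 1 N (dN t)) ->
  (forall t, t \in `[a, b] -> `|dN t| <= K * N t) ->
  forall s t, s \in `[a, b] -> t \in `[a, b] ->
  N t <= expR (K * `|t - s|) * N s.
Proof.
move=> K0 dN_ H s t sab tab.
have sub (u v : R) : u \in `[a, b] -> v \in `[a, b] ->
    forall x, x \in `[u, v] -> x \in `[a, b].
  move=> /[1!in_itv]/= /andP[? ?] /[1!in_itv]/= /andP[? ?] x.
  by move=> /[1!in_itv]/= /andP[? ?]; rewrite in_itv/=; apply/andP; split; lra.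
have dP k x : x \in `[a, b] -> is_derive x 1 (fun t => N t * expR (k * t))
     (expR (k * x) * (dN x + k * N x)).
  move=> xab.
  have := is_derive_mulr (dN_ _ xab) (is_derive_expR_linear k x).
  by move=> h; apply: (is_derive_eq h); ring.
have [st|ts] := leP s t.
  have hd x : x \in `[s, t] -> _ := fun xst => dP (- K) x (sub _ _ sab tab x xst).
  have := nonincreasing_is_derive st hd.
  have hd0 x : x \in `[s, t] -> expR (- K * x) * (dN x + - K * N x) <= 0.
    move=> xst; rewrite mulr_ge0_le0 ?expR_ge0//.
    have := H x (sub _ _ sab tab x xst); rewrite ler_norml => /andP[]; lra.
  move=> /(_ hd0) h.
  rewrite ger0_norm ?subr_ge0//.
  rewrite mulrBr expRB -(ler_pM2r (expR_gt0 (- K * t))).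
  apply: (le_trans h); rewrite !mulNr !expRN.
  rewrite le_eqVlt; apply/orP; left; apply/eqP; field.
  by rewrite !gt_eqF ?expR_gt0.
have hd x : x \in `[t, s] -> _ := fun xst => dP K x (sub _ _ tab sab x xst).
have := nondecreasing_is_derive (ltW ts) hd.
have hd0 x : x \in `[t, s] -> 0 <= expR (K * x) * (dN x + K * N x).
  move=> xst; rewrite mulr_ge0 ?expR_ge0//.
  have := H x (sub _ _ tab sab x xst); rewrite ler_norml => /andP[]; lra.
move=> /(_ hd0) h.
rewrite ltr0_norm ?subr_lt0//.
rewrite opprB mulrBr expRB -(ler_pM2r (expR_gt0 (K * t))).
apply: (le_trans h).
rewrite le_eqVlt; apply/orP; left; apply/eqP; field.
by rewrite !gt_eqF ?expR_gt0.
Qed.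

End RealCalculus.

(** * Row vectors and the scalar product *)

Section EpsDelta.
Context {R : realType} {V W : normedModType R}.

Lemma continuous_epsdelta (f : V -> W) x :
  {for x, continuous f} <-> forall e, 0 < e ->
    exists2 d, 0 < d & forall y, `|x - y| < d -> `|f x - f y| < e.
Proof.
split=> [/cvgrPdist_lt H e e0|H].
  by have /nbhs_ballP[d d0 Hd] := H e e0; exists d => // y xy; apply: Hd;
    rewrite -ball_normE.
apply/cvgrPdist_lt => e e0; have [d d0 Hd] := H e e0.
by apply/nbhs_ballP; exists d => // y; rewrite -ball_normE => /Hd.
Qed.

Lemma continuous_epsdelta_fin (I : finType) (f : I -> V -> W) x :
  (forall i, {for x, continuous (f i)}) -> forall e, 0 < e ->
    exists2 d, 0 < d & forall i y, `|x - y| < d -> `|f i x - f i y| < e.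
Proof.
move=> cf e e0.
have : \forall y \near x, forall i, `|f i x - f i y| < e.
  apply: filter_forall => i; have /cvgrPdist_lt := cf i; exact.
move=> /nbhs_ballP[d d0 Hd]; exists d => // i y xy.
by apply: Hd; rewrite -ball_normE.
Qed.

Lemma continuous_subr (c : V) : continuous (fun x : V => x - c).
Proof. by move=> x; apply: cvgB; [exact: cvg_id | exact: cvg_cst]. Qed.

Lemma continuous_dist (c : V) : continuous (fun x : V => `|x - c|).
Proof. by move=> x; apply: cvg_norm; exact: continuous_subr. Qed.

Lemma continuous_le_closure (f g : V -> R) x : continuous f -> continuous g ->
  (forall e, 0 < e -> exists y, `|x - y| < e /\ f y <= g y) -> f x <= g x.
Proof.
move=> cf cg H; rewrite -subr_le0; apply/ler_addgt0Pr => e e0.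
have cfg : {for x, continuous (fun y => f y - g y)}.
  by apply: cvgB; [exact: cf | exact: cg].
have /cvgrPdist_lt /(_ _ e0) /nbhs_ballP[d d0 Hd] := cfg.
have [y [xy fy]] := H _ d0.
have := Hd y; rewrite -ball_normE => /(_ xy) /=.
have := ler_norm (f x - g x - (f y - g y)).
by move: fy; move: (f x) (f y) (g x) (g y) => a b c d'; lra.
Qed.

Lemma continuous_scale_sqr (f : V -> R) c : continuous f ->
  continuous (fun x => c * f x ^+ 2).
Proof.
by move=> cf x; apply: cvgM; [exact: cvg_cst | apply: cvgM; exact: cf].
Qed.

End EpsDelta.

Lemma is_derive_lincomb {R : realType} {V : normedModType R} m (c : 'I_m -> R)
    (q : 'I_m -> V -> R) (dq : 'I_m -> R) (x v : V) :
  (forall i, is_derive x v (q i) (dq i)) ->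
  is_derive x v (fun y => \sum_i c i * q i y) (\sum_i c i * dq i).
Proof.
move=> Hq.
have d i : is_derive x v (fun y => c i * q i y) (c i * dq i).
  have := is_deriveM (is_derive_cst (c i) x v) (Hq i).
  by move=> k; apply: (is_derive_eq k); rewrite scaler0 addr0.
have := is_derive_sum d.
rewrite (_ : \sum_(i < m) _ = fun y => \sum_i c i * q i y)//.
by apply/funext => y; rewrite fct_sumE.
Qed.

Section Vectors.
Context {R : realType} {n : nat}.
Implicit Types (x y z : 'rV[R]_n) (c t : R).

Lemma coord_le_norm x i : `|x ord0 i| <= `|x|.
Proof.
rewrite [leRHS]/Num.norm/= mx_normrE.
exact: (le_bigmax _ (fun ij : 'I_1 * 'I_n => `|x ij.1 ij.2|) (ord0, i)).
Qed.

Lemma norm_le_coord x c : 0 <= c -> (forall i, `|x ord0 i| <= c) -> `|x| <= c.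
Proof.
move=> c0 H; rewrite [leLHS]/Num.norm/= mx_normrE bigmax_le// => -[i j] _ /=.
by rewrite (ord1 i).
Qed.

Lemma dotC x y : dot x y = dot y x.
Proof. by apply: eq_bigr => i _; rewrite mulrC. Qed.

Lemma dotDl x y z : dot (x + y) z = dot x z + dot y z.
Proof. by rewrite -big_split; apply: eq_bigr => i _; rewrite mxE mulrDl. Qed.

Lemma dotZl c x y : dot (c *: x) y = c * dot x y.
Proof. by rewrite mulr_sumr; apply: eq_bigr => i _; rewrite mxE mulrA. Qed.

Lemma dotNl x y : dot (- x) y = - dot x y.
Proof. by rewrite -scaleN1r dotZl mulN1r. Qed.

Lemma dotBl x y z : dot (x - y) z = dot x z - dot y z.
Proof. by rewrite dotDl dotNl. Qed.

Lemma dot0l x : dot 0 x = 0.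
Proof. by rewrite -(scale0r 0) dotZl mul0r. Qed.

Lemma dotDr x y z : dot z (x + y) = dot z x + dot z y.
Proof. by rewrite ![dot z _]dotC dotDl. Qed.

Lemma dotZr c x y : dot y (c *: x) = c * dot y x.
Proof. by rewrite ![dot y _]dotC dotZl. Qed.

Lemma dotNr x y : dot y (- x) = - dot y x.
Proof. by rewrite ![dot y _]dotC dotNl. Qed.

Lemma dotBr x y z : dot z (x - y) = dot z x - dot z y.
Proof. by rewrite dotDr dotNr. Qed.

Lemma dot_ge0 x : 0 <= dot x x.
Proof. by apply: sumr_ge0 => i _; exact: sqr_ge0. Qed.

Lemma sqr_norm_le_dot x : `|x| ^+ 2 <= dot x x.
Proof.
have H i : `|x ord0 i| ^+ 2 <= dot x x.
  rewrite /dot (bigD1 i)//= real_normK ?num_real// -expr2 lerDl.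
  by apply: sumr_ge0 => j _; exact: sqr_ge0.
rewrite -(sqr_sqrtr (dot_ge0 x)) ler_sqr ?nnegrE ?sqrtr_ge0//.
apply: norm_le_coord => [|i]; first exact: sqrtr_ge0.
by rewrite -(ler_sqr (normr_ge0 _)) ?nnegrE ?sqrtr_ge0// sqr_sqrtr ?dot_ge0.
Qed.

Lemma dot_eq0 x : dot x x = 0 -> x = 0.
Proof.
move=> E; apply/eqP; rewrite -normr_eq0 -sqrf_eq0 eq_le sqr_ge0 andbT -E.
exact: sqr_norm_le_dot.
Qed.

Lemma dot_gt0 x : x != 0 -> 0 < dot x x.
Proof.
move=> x0; rewrite lt_neqAle dot_ge0 andbT eq_sym.
by apply: contra x0 => /eqP /dot_eq0 ->.
Qed.

(** The factor [n] is the price of the sup norm and the source of most factors [n%:R] in later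
    constants. *)
Lemma norm_dot_le x y : `|dot x y| <= n%:R * `|x| * `|y|.
Proof.
apply: (le_trans (ler_norm_sum _ _ _)).
rewrite -mulrA mulr_natl -[leRHS](_ : \sum_(i < n) `|x| * `|y| = _); last first.
  by rewrite sumr_const card_ord.
by apply: ler_sum => i _; rewrite normrM ler_pM ?coord_le_norm.
Qed.

Lemma dot_le_sqr_norm x : dot x x <= n%:R * `|x| ^+ 2.
Proof. by rewrite expr2 mulrA (le_trans (ler_norm _))// norm_dot_le. Qed.

Lemma norm_unit_le1 x : dot x x = 1 -> `|x| <= 1.
Proof.
move=> x1; rewrite -(ler_sqr (normr_ge0 _)) ?nnegrE// expr1n -x1.
exact: sqr_norm_le_dot.
Qed.

Lemma is_derive_rowP (w : R -> 'rV[R]_n) (dw : 'rV[R]_n) t :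
  is_derive t 1 w dw <->
  forall i, is_derive t 1 (fun s => w s ord0 i) (dw ord0 i).
Proof.
split=> [[dfw <-] i|H].
  have dfi := (derivable_mxP w t 1).1 dfw.
  split; first exact: dfi.
  by rewrite derive_mx// mxE.
have dfw : derivable w t 1.
  by apply/derivable_mxP => i j; rewrite (ord1 i); have [] := H j.
split=> //; rewrite derive_mx//; apply/rowP => i; rewrite mxE.
by have [_ ->] := H i.
Qed.

Lemma is_derive_dot (w v : R -> 'rV[R]_n) (dw dv : 'rV[R]_n) t :
  is_derive t 1 w dw -> is_derive t 1 v dv ->
  is_derive t 1 (fun s => dot (w s) (v s)) (dot dw (v t) + dot (w t) dv).
Proof.
move=> /is_derive_rowP Hw /is_derive_rowP Hv.
have := is_derive_sum (fun i => is_derive_mulr (Hw i) (Hv i)).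
rewrite (_ : \sum_(i < n) _ = fun s => dot (w s) (v s)); last first.
  by apply/funext => s; rewrite fct_sumE.
move=> h; apply: (is_derive_eq h); rewrite -big_split/=.
by apply: eq_bigr => i _; rewrite addrC [v _ _ _ * _]mulrC.
Qed.

Lemma cvg_sum_ord {U : Type} (F : set_system U) {FF : Filter F} m
    (w : 'I_m -> U -> R) (l : 'I_m -> R) :
  (forall i, w i u @[u --> F] --> l i) ->
  \sum_i w i u @[u --> F] --> \sum_i l i.
Proof.
move=> H; elim: (index_enum _) => [|i s IH].
  under eq_cvg do rewrite big_nil.
  rewrite big_nil; exact: cvg_cst.
under eq_cvg do rewrite big_cons.
by rewrite big_cons; apply: cvgD.
Qed.

Lemma continuous_lincomb {U : topologicalType} m (c : 'I_m -> R) (q : 'I_m -> U -> R) :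
  (forall i, continuous (q i)) -> continuous (fun u => \sum_i c i * q i u).
Proof.
by move=> cq u; apply: cvg_sum_ord => i; apply: cvgM; [exact: cvg_cst | exact: cq].
Qed.

Lemma continuous_coord {U : topologicalType} (w : U -> 'rV[R]_n) i :
  continuous w -> continuous (fun u => w u ord0 i).
Proof.
move=> cw u; apply: (cvg_comp w (fun y : 'rV[R]_n => y ord0 i)); first exact: cw.
exact: coord_continuous.
Qed.

Lemma continuous_dot {U : topologicalType} (w v : U -> 'rV[R]_n) :
  continuous w -> continuous v -> continuous (fun u => dot (w u) (v u)).
Proof.
by move=> cw cv u; apply: cvg_sum_ord => i; apply: cvgM; apply: continuous_coord.
Qed.

End Vectors.

(** * Global solutions of Lipschitz differential equations *)

Section Picard.
Context {R : realType}.

Lemma eq_antiderivative (F G h : R -> R) (s t : R) :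
  (forall x, x \in `[Num.min s t, Num.max s t] -> is_derive x 1 F (h x)) ->
  (forall x, x \in `[Num.min s t, Num.max s t] -> is_derive x 1 G (h x)) ->
  F s = G s -> F t = G t.
Proof.
set a := Num.min s t; set b := Num.max s t => dF dG E.
have dD x : x \in `[a, b] -> is_derive x 1 (fun y => F y - G y) 0.
  move=> xab; have := is_deriveB (dF x xab) (dG x xab).
  by move=> k; apply: (is_derive_eq k); rewrite subrr.
have ab : a <= b by rewrite /a /b; case: (leP s t) => [|/ltW].
have [c _] := MVT_is_derive ab dD.
rewrite mul0r /a /b; case: (leP s t) => _; move: E; lra.
Qed.

Lemma antiderivative (h : R -> R) : continuous h ->
  exists H : R -> R, H 0 = 0 /\ forall t : R, is_derive t 1 H (h t).
Proof.
move=> ch.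
pose I a t := (\int[lebesgue_measure]_(x in `[a, t]) h x)%R.
have dI (a t : R) : a < t -> is_derive t 1 (I a) (h t).
  move=> at_.
  have tt1 : t < t + 1 by lra.
  have hi : lebesgue_measure.-integrable `[a, t + 1] (EFin \o h).
    apply: continuous_compact_integrable; first exact: segment_compact.
    exact: continuous_subspaceT.
  have [d1 d2] := continuous_FTC1_closed tt1 hi at_ (ch t).
  by split; [exact: d1 | rewrite -derive1E; exact: d2].
pose K M t := I (- M) t - I (- M) 0.
have dK (M t : R) : - M < t -> is_derive t 1 (K M) (h t).
  move=> Mt; have := is_deriveB (dI _ _ Mt) (is_derive_cst (I (- M) 0) t 1).
  by move=> k; apply: (is_derive_eq k); rewrite subr0.
have K0 M : K M 0 = 0 by rewrite /K subrr.
have KE (M M' t : R) : 0 < M -> 0 < M' -> - M < t -> - M' < t -> K M t = K M' t.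
  move=> M0 M0' Mt Mt'; apply: (@eq_antiderivative (K M) (K M') h 0 t).
  - move=> x xab; apply: dK; move: xab; rewrite in_itv/= => /andP[+ _].
    by case: (leP 0 t) => ? ?; lra.
  - move=> x xab; apply: dK; move: xab; rewrite in_itv/= => /andP[+ _].
    by case: (leP 0 t) => ? ?; lra.
  - by rewrite !K0.
(* An integral from [- M] is an antiderivative only to the right of [- M]. Normalised at 0, those
   for different [M] agree, so the base point may move with [t]; near a given [t] it is frozen at
   [- (|t| + 2)]. *)
exists (fun t => K (`|t| + 1) t); split; first by rewrite K0.
move=> t; have tM : - (`|t| + 2) < t by have := ler_norm (- t); rewrite normrN; lra.
apply: (near_eq_is_derive _ (dK _ _ tM)).
near=> s.
have st : `|t - s| < 1.
  near: s.
  by apply: (@cvgr_dist_lt _ _ _ _ _ id t) => //.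
have ns := ler_norm (- s); rewrite normrN in ns.
have nt := ler_norm (- t); rewrite normrN in nt.
apply: KE.
- by have := normr_ge0 t; lra.
- by have := normr_ge0 s; lra.
- have := ler_norm (t - s); lra.
- by lra.
Unshelve. all: by end_near. Qed.

Lemma geometric_limit n (u : nat -> 'rV[R]_n) (C : R) : 0 <= C ->
  (forall k, `|u k.+1 - u k| <= C * 2^-1 ^+ k) ->
  exists l, forall k, `|l - u k| <= 2 * C * 2^-1 ^+ k.
Proof.
move=> C0 H.
have P k j : `|u (k + j)%N - u k| <= 2 * C * 2^-1 ^+ k.
  (* The factor 1 - 2^-j is the exact partial sum of the geometric series; with it the induction on
     [j] closes. *)
  suff : `|u (k + j)%N - u k| <= 2 * C * 2^-1 ^+ k * (1 - 2^-1 ^+ j).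
    have p (i : nat) : 0 <= (2^-1 : R) ^+ i by rewrite exprn_ge0.
  move=> /le_trans; apply; rewrite mulrBr mulr1 lerBlDr lerDl.
  by rewrite !mulr_ge0.
  elim: j => [|j IH]; first by rewrite addn0 subrr normr0 expr0 subrr mulr0.
  rewrite addnS -(subrKA (u (k + j)%N)).
  rewrite (le_trans (ler_normD _ _))// (le_trans (lerD (H _) IH))//.
  rewrite exprD exprS le_eqVlt; apply/orP; left; apply/eqP.
  by field.
have geo0 : (fun k => 2 * C * 2^-1 ^+ k : R) @ \oo --> (0 : R).
  rewrite -[X in _ --> X](mulr0 (2 * C)).
  apply: cvgM; first exact: cvg_cst.
  by apply: cvg_expr; rewrite ger0_norm// invf_lt1// ltr1n.
have cu : cauchy (u @ \oo).
  apply: cauchy_exP => e e0.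
  have : \forall k \near \oo, `|0 - 2 * C * 2^-1 ^+ k| < e.
    by move/cvgrPdist_lt : geo0; apply.
  move=> [k _ /(_ k (leqnn k))] /= Hk.
  exists (u k), k => // m /= km; rewrite -ball_normE /ball_/= distrC.
  rewrite -(subnKC km) (le_lt_trans (P _ _))// (le_lt_trans _ Hk)//.
  by rewrite sub0r normrN ler_norm.
have cvu : cvg (u @ \oo) by apply: cauchy_cvg.
have [l cl] := (cvg_ex _).1 cvu.
exists l => k; apply/ler_addgt0Pr => e e0.
have [N _ HN] : \forall m \near \oo, `|l - u m| < e by move/cvgrPdist_lt : cl; apply.
have := HN (k + N)%N (leq_addl _ _) => /= HkN.
rewrite -(subrKA (u (k + N)%N)) (le_trans (ler_normD _ _))// addrC lerD//.
exact: ltW.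
Qed.

Lemma row_antiderivative n (v : R -> 'rV[R]_n) : continuous v ->
  exists W : R -> 'rV[R]_n, W 0 = 0 /\ forall t : R, is_derive t 1 W (v t).
Proof.
move=> cv.
have /choice [W HW] : forall i, exists H : R -> R,
    H 0 = 0 /\ forall t : R, is_derive t 1 H (v t ord0 i).
  by move=> i; apply: antiderivative; exact: continuous_coord.
exists (fun t => \row_i W i t); split.
  by apply/rowP => i; rewrite !mxE (HW i).1.
move=> t; apply/is_derive_rowP => i.
rewrite (_ : (fun s : R => _) = W i); first exact: (HW i).2.
by apply/funext => s; rewrite mxE.
Qed.

(** Twice cosh(2 L t), the weight of a Bielecki norm for Picard iteration. It is even, so both
    directions of time are treated at once, and its rate 2L makes the iteration contract by 1/2. *)
Let E (L : R) (t : R) : R := expR (2 * L * t) + expR (- (2 * L) * t).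

(** Each coordinate is compared with [c * S], which vanishes at 0 and has derivative [K * E L].
    Since |S| <= E, one integration gains the factor 1/(2L). *)
Lemma exp_growth_bound n (L K : R) (h : R -> 'rV[R]_n) (dh : R -> 'rV[R]_n) :
  0 < L -> 0 <= K -> h 0 = 0 ->
  (forall t : R, is_derive t 1 h (dh t)) ->
  (forall t, `|dh t| <= K * E L t) ->
  forall t, `|h t| <= K / (2 * L) * E L t.
Proof.
move=> L0 K0 h0 dh_ H t.
have E0 s : 0 <= E L s by rewrite addr_ge0 ?expR_ge0.
apply: norm_le_coord => [|i].
  by rewrite !mulr_ge0// invr_ge0 mulr_ge0// ltW.
pose S (s : R) : R := expR (2 * L * s) - expR (- (2 * L) * s).
pose c : R := K / (2 * L).
have L2 : 2 * L != 0 by rewrite mulf_neq0// gt_eqF.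
have dS (s : R) : is_derive s 1 (fun s => c * S s) (K * E L s).
  have k1 := is_deriveB (is_derive_expR_linear (2 * L) s)
                        (is_derive_expR_linear (- (2 * L)) s).
  have k2 := is_derive_mulr (is_derive_cst c s 1) k1.
  apply: (is_derive_eq k2); rewrite /cst /E /c mulr0 addr0; field.
  by move: L0; lra.
have dhi (s : R) : is_derive s 1 (fun s => h s ord0 i) (dh s ord0 i).
  by have /is_derive_rowP := dh_ s.
have bd s : - (K * E L s) <= dh s ord0 i <= K * E L s.
  by rewrite -ler_norml (le_trans (coord_le_norm _ _)).
have dp (s : R) : is_derive s 1 (fun s => c * S s + h s ord0 i)
    (K * E L s + dh s ord0 i) by exact: is_deriveD (dS s) (dhi s).
have dm (s : R) : is_derive s 1 (fun s => c * S s - h s ord0 i)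
    (K * E L s - dh s ord0 i) by exact: is_deriveB (dS s) (dhi s).
have S00 : S 0 = 0 by rewrite /S !mulr0 subrr.
have hi0 : h 0 ord0 i = 0 by rewrite h0 mxE.
have c0 : 0 <= c by rewrite divr_ge0// mulr_ge0// ltW.
have SE : - E L t <= S t <= E L t.
  have := expR_ge0 (2 * L * t); have := expR_ge0 (- (2 * L) * t).
  by rewrite /S /E => ? ?; apply/andP; split; lra.
have cSE : - (c * E L t) <= c * S t <= c * E L t.
  by move/andP: SE => [? ?]; rewrite -mulrN !ler_wpM2l.
rewrite ler_norml -/c.
have [t0|t0] := leP 0 t.
- have := nondecreasing_is_derive t0 (fun s _ => dp s).
  have := nondecreasing_is_derive t0 (fun s _ => dm s).
  rewrite S00 hi0 mulr0 subr0 addr0 => A B.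
  have {}A : 0 <= c * S t - h t ord0 i.
    by apply: A => s _; have /andP[] := bd s; lra.
  have {}B : 0 <= c * S t + h t ord0 i.
    by apply: B => s _; have /andP[] := bd s; lra.
  by move/andP: cSE => [? ?]; apply/andP; split; lra.
- have := nondecreasing_is_derive (ltW t0) (fun s _ => dp s).
  have := nondecreasing_is_derive (ltW t0) (fun s _ => dm s).
  rewrite S00 hi0 mulr0 subr0 addr0 => A B.
  have {}A : c * S t - h t ord0 i <= 0.
    by apply: A => s _; have /andP[] := bd s; lra.
  have {}B : c * S t + h t ord0 i <= 0.
    by apply: B => s _; have /andP[] := bd s; lra.
  by move/andP: cSE => [? ?]; apply/andP; split; lra.
Qed.

Lemma lipschitz_continuous n (G : 'rV[R]_n -> 'rV[R]_n) (L : R) : 0 < L ->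
  (forall x y, `|G x - G y| <= L * `|x - y|) -> continuous G.
Proof.
move=> L0 HG x; apply/continuous_epsdelta => e e0.
exists (e / L) => [|y xy]; first by rewrite divr_gt0.
by rewrite (le_lt_trans (HG _ _))// mulrC -ltr_pdivlMr.
Qed.

(** The weighted estimate is valid on the whole line, so the iteration converges globally in time
    and no local solutions have to be continued or glued. *)
Theorem picard n (G : 'rV[R]_n -> 'rV[R]_n) (L : R) (x0 : 'rV[R]_n) : 0 < L ->
  (forall x y, `|G x - G y| <= L * `|x - y|) ->
  exists w : R -> 'rV[R]_n, w 0 = x0 /\ forall t : R, is_derive t 1 w (G (w t)).
Proof.
move=> L0 HG.
have cG := lipschitz_continuous L0 HG.
have /choice [P HP] : forall v : R -> 'rV[R]_n, exists W : R -> 'rV[R]_n,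
    continuous v -> W 0 = 0 /\ forall t : R, is_derive t 1 W (v t).
  move=> v; have [cv|ncv] := pselect (continuous v); last by exists v.
  by have [W HW] := row_antiderivative cv; exists W.
pose Phi (v : R -> 'rV[R]_n) : R -> 'rV[R]_n := fun t => x0 + P (fun s => G (v s)) t.
have Phi0 v : continuous v -> Phi v 0 = x0.
  move=> cv; rewrite /Phi (HP _ _).1 ?addr0// => t.
  by apply: (cvg_comp v G); [exact: cv|exact: cG].
have dPhi v : continuous v -> forall t : R, is_derive t 1 (Phi v) (G (v t)).
  move=> cv t.
  have cGv : continuous (fun s => G (v s)).
    by move=> s; apply: (cvg_comp v G); [exact: cv|exact: cG].
  have := is_deriveD (is_derive_cst x0 t 1) ((HP _ cGv).2 t).
  by move=> k; apply: (is_derive_eq k); rewrite add0r.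
have cPhi v : continuous v -> continuous (Phi v).
  by move=> cv t; apply: (is_derive_continuous (dPhi v cv t)).
pose w k := iter k Phi (fun=> x0).
have cw k : continuous (w k).
  by elim: k => [|k IH]; [move=> t; exact: cvg_cst | exact: cPhi].
have E1 t : 1 <= E L t.
  rewrite /E; have [t0|t0] := leP 0 t.
    have : 1 <= expR (2 * L * t) by rewrite -expR0 ler_expR !mulr_ge0// ltW.
    by have := expR_ge0 (- (2 * L) * t); lra.
  have : 1 <= expR (- (2 * L) * t).
    by rewrite -expR0 ler_expR mulr_le0// ?oppr_le0 ?mulr_ge0// ltW.
  by have := expR_ge0 (2 * L * t); lra.
have EL0 t : 0 <= E L t by rewrite (le_trans ler01).
(* The Lipschitz constant [L] against the gain 1/(2L): a contraction by 1/2 in the weighted norm. *)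
have step u v (K : R) : 0 <= K -> continuous u -> continuous v ->
    (forall t, `|u t - v t| <= K * E L t) ->
    forall t, `|Phi u t - Phi v t| <= K / 2 * E L t.
  move=> K0 cu cv H t.
  have dh (s : R) : is_derive s 1 (fun s => Phi u s - Phi v s) (G (u s) - G (v s)).
    exact: is_deriveB (dPhi _ cu s) (dPhi _ cv s).
  have LK : 0 <= L * K by rewrite mulr_ge0// ltW.
  have h0 : Phi u 0 - Phi v 0 = 0 by rewrite !Phi0// subrr.
  have := exp_growth_bound L0 LK h0 dh.
  rewrite (_ : L * K / (2 * L) = K / 2); last by field; rewrite gt_eqF.
  apply=> s; rewrite (le_trans (HG _ _))// -mulrA ler_wpM2l//; exact: ltW.
pose C : R := `|G x0| / (2 * L).
have C0 : 0 <= C by rewrite divr_ge0// mulr_ge0// ltW.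
have wS k t : `|w k.+1 t - w k t| <= C * 2^-1 ^+ k * E L t.
  elim: k t => [t|k IH t].
    rewrite expr0 mulr1 /w/=.
    have dh (s : R) : is_derive s 1 (fun s => Phi (fun=> x0) s - x0) (G x0).
      have := is_deriveB (dPhi _ (cw 0%N) s) (is_derive_cst x0 s 1).
      by move=> k; apply: (is_derive_eq k); rewrite subr0.
    have h0 : Phi (fun=> x0) 0 - x0 = 0 by rewrite Phi0 ?subrr//; exact: (cw 0%N).
    apply: (exp_growth_bound L0 (normr_ge0 _) h0 dh) => s.
    by rewrite ler_peMr.
  rewrite exprSr mulrA; have Kk : 0 <= C * 2^-1 ^+ k by rewrite mulr_ge0// exprn_ge0.
  exact: (step (w k.+1) (w k) _ Kk (cw k.+1) (cw k) IH t).
have /choice [W HW] : forall t, exists l, forall k,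
    `|l - w k t| <= 2 * (C * E L t) * 2^-1 ^+ k.
  move=> t; apply: geometric_limit => [|k]; first by rewrite mulr_ge0.
  by rewrite mulrAC.
have HW' k t : `|W t - w k t| <= (2 * C * 2^-1 ^+ k) * E L t.
  by rewrite (le_trans (HW _ _))// le_eqVlt; apply/orP; left; apply/eqP; ring.
have geo (K e : R) : 0 < e -> exists k, K * 2^-1 ^+ k < e.
  move=> e0.
  have geo0 : (fun k => K * 2^-1 ^+ k : R) @ \oo --> (0 : R).
    rewrite -[X in _ --> X](mulr0 K); apply: cvgM; first exact: cvg_cst.
    by apply: cvg_expr; rewrite ger0_norm// invf_lt1// ltr1n.
  have [k _ /(_ k (leqnn k))/= Hk] : \forall k \near \oo, `|0 - K * 2^-1 ^+ k| < e.
    by move/cvgrPdist_lt : geo0; apply.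
  by exists k; rewrite (le_lt_trans _ Hk)// sub0r normrN ler_norm.
have cE : continuous (E L).
  move=> t; have k1 := is_deriveD (is_derive_expR_linear (2 * L) t)
                        (is_derive_expR_linear (- (2 * L)) t).
  exact: (is_derive_continuous k1).
(* Near [t] the weight is at most [E L t + 1], so the convergence is locally uniform and the usual
   three-term argument applies. *)
have cW : continuous W.
  move=> t; apply/cvgrPdist_lt => e e0.
  have [k Hk] := geo (2 * C * (E L t + 1)) (e / 3) ltac:(lra).
  near=> s.
  have Es : E L s <= E L t + 1.
    have : `|E L t - E L s| < 1.
      by near: s; apply: (cvgr_dist_lt _ _) => //; exact: cE.
    by have := ler_norm (- (E L t - E L s)); rewrite normrN; lra.
  have b r : E L r <= E L t + 1 -> `|W r - w k r| < e / 3.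
    move=> Er; rewrite (le_lt_trans (HW' k r))// (le_lt_trans _ Hk)//.
    rewrite mulrAC ler_wpM2r ?exprn_ge0// ler_wpM2l// mulr_ge0//.
  have b1 := b t ltac:(lra).
  have b2 := b s Es; rewrite distrC in b2.
  have b3 : `|w k t - w k s| < e / 3.
    near: s; apply: (cvgr_dist_lt _ _); last by lra.
    exact: cw.
  rewrite -(subrKA (w k t)) -[w k t - W s](subrKA (w k s)).
  rewrite (le_lt_trans (ler_normD _ _))//.
  have := ler_normD (w k t - w k s) (w k s - W s); lra.
have WE : Phi W = W.
  apply/funext => t; apply/eqP; rewrite -subr_eq0 -normr_le0.
  apply/ler_addgt0Pr => e e0; rewrite add0r.
  have [k Hk] := geo (2 * C * E L t) e e0.
  have KC : 0 <= 2 * C * 2^-1 ^+ k.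
    by apply: mulr_ge0; [exact: mulr_ge0 | exact: exprn_ge0].
  have s1 := step W (w k) _ KC cW (cw k) (HW' k) t.
  have s2 := HW' k.+1 t.
  rewrite -(subrKA (w k.+1 t)) (le_trans (ler_normD _ _))//.
  rewrite [X in _ + X]distrC.
  rewrite (le_trans (lerD s1 s2))// (le_trans _ (ltW Hk))// le_eqVlt.
  by apply/orP; left; apply/eqP; rewrite exprS; field.
exists W; split; first by rewrite -WE Phi0.
by move=> t; rewrite -[in X in is_derive _ _ X _]WE; exact: dPhi.
Unshelve. all: by end_near. Qed.

End Picard.

(** * Truncation onto a ball of the sup norm *)

Section Clip.
Context {R : realType} {n : nat}.
Implicit Types (x y : 'rV[R]_n) (M : R).

(** Truncating each coordinate projects onto the ball of the sup norm, and for that norm the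
    projection is 1-Lipschitz; a radial projection would not fit the norm as well. *)
Definition clip M x : 'rV[R]_n := \row_i Num.max (- M) (Num.min M (x ord0 i)).

Lemma norm_clip_le M x : 0 <= M -> `|clip M x| <= M.
Proof.
move=> M0; apply: norm_le_coord => // i; rewrite mxE ler_norml.
by rewrite le_max lexx/= ge_max ge_min lexx/= andbT; lra.
Qed.

Lemma clip_id M x : `|x| <= M -> clip M x = x.
Proof.
move=> xM; apply/rowP => i; rewrite mxE.
have := le_trans (coord_le_norm x i) xM; rewrite ler_norml => /andP[? ?].
by rewrite min_r// max_r.
Qed.

Lemma clip_lipschitz M x y : 0 <= M -> `|clip M x - clip M y| <= `|x - y|.
Proof.
move=> M0; apply: norm_le_coord => // i; rewrite !mxE.
have := coord_le_norm (x - y) i; rewrite !mxE; apply: le_trans.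
move: (x ord0 i) (y ord0 i) => a b.
have E c : (M <= c /\ Num.max (- M) (Num.min M c) = M) \/
           (c <= - M /\ Num.max (- M) (Num.min M c) = - M) \/
           (- M <= c /\ c <= M /\ Num.max (- M) (Num.min M c) = c).
  case: (leP M c) => Mc; first by left; split=> //; rewrite max_r//; lra.
  case: (leP (- M) c) => ?; first by right; right; split=> //; split=> //; exact: ltW.
  by right; left; split=> //; exact: ltW.
have := ler_norm (a - b); have := ler_norm (- (a - b)); rewrite normrN => ? ?.
by rewrite ler_norml;
  case: (E a) => [[? ->]|[[? ->]|[? [? ->]]]];
  case: (E b) => [[? ->]|[[? ->]|[? [? ->]]]]; apply/andP; split; lra.
Qed.

End Clip.

(** * Comparison, uniqueness and invariance for autonomous equations *)

Section ODE.
Context {R : realType} {n : nat}.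
Implicit Types (x y : 'rV[R]_n) (w v : R -> 'rV[R]_n) (G : 'rV[R]_n -> 'rV[R]_n).

Lemma is_derive_dist (w v : R -> 'rV[R]_n) (dw dv : 'rV[R]_n) (t : R) :
  is_derive t 1 w dw -> is_derive t 1 v dv ->
  is_derive t 1 (fun s => w s - v s) (dw - dv).
Proof. by move=> ? ?; exact: is_deriveB. Qed.

(** The squared Euclidean distance is used because it is differentiable. Its derivative 2 d.d' is at
    most 2 n |d| |d'| in sup norms, whence the rate 2 n K. *)
Lemma gronwall_dist (w v dw dv : R -> 'rV[R]_n) (a b K : R) : 0 <= K ->
  (forall t, t \in `[a, b] -> is_derive t 1 w (dw t)) ->
  (forall t, t \in `[a, b] -> is_derive t 1 v (dv t)) ->
  (forall t, t \in `[a, b] -> `|dw t - dv t| <= K * `|w t - v t|) ->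
  forall s t, s \in `[a, b] -> t \in `[a, b] ->
  dot (w t - v t) (w t - v t) <=
    expR (2 * n%:R * K * `|t - s|) * dot (w s - v s) (w s - v s).
Proof.
move=> K0 dw_ dv_ H.
pose d s := w s - v s; pose dd s := dw s - dv s.
have dN t : t \in `[a, b] ->
    is_derive t 1 (fun s => dot (d s) (d s)) (2 * dot (d t) (dd t)).
  move=> tab; have dt := is_derive_dist (dw_ t tab) (dv_ t tab).
  have := is_derive_dot dt dt.
  by move=> k; apply: (is_derive_eq k); rewrite dotC -mulr2n mulr_natl.
have nK0 : 0 <= 2 * n%:R * K by rewrite !mulr_ge0.
apply: (gronwall nK0 dN) => t tab.
rewrite normrM ger0_norm// -!mulrA ler_pM2l//.
rewrite (le_trans (norm_dot_le _ _))// -mulrA ler_wpM2l//.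
rewrite (@le_trans _ _ (`|d t| * (K * `|d t|)))//.
  by rewrite ler_wpM2l//; exact: H.
by rewrite mulrCA ler_wpM2l// -expr2 sqr_norm_le_dot.
Qed.

Lemma is_derive_bounded w (dw : R -> 'rV[R]_n) (a b : R) :
  (forall t : R, is_derive t 1 w (dw t)) ->
  exists M, forall t, t \in `[a, b] -> `|w t| <= M.
Proof.
move=> dw_; have [ab|ba] := leP a b; last first.
  by exists 0 => t; rewrite in_itv/= => /andP[? ?]; lra.
have cw : continuous (fun t => `|w t|).
  move=> t; apply: cvg_norm; exact: (is_derive_continuous (dw_ t)).
have [c _ H] := EVT_max ab (continuous_subspaceT cw).
by exists `|w c|.
Qed.

(** A local Lipschitz bound suffices: between [s0] and [t] both solutions stay in one ball, and
    Gronwall with the constant of that ball propagates the zero difference. *)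
Lemma ode_unique G w v (s0 : R) :
  (forall M, exists2 K, 0 <= K & forall a b, `|a| <= M -> `|b| <= M ->
     `|G a - G b| <= K * `|a - b|) ->
  (forall t : R, is_derive t 1 w (G (w t))) ->
  (forall t : R, is_derive t 1 v (G (v t))) ->
  w s0 = v s0 -> forall t, w t = v t.
Proof.
move=> lipG dw dv E t.
pose a := Num.min s0 t; pose b := Num.max s0 t.
have [M1 H1] := is_derive_bounded a b dw.
have [M2 H2] := is_derive_bounded a b dv.
have [K K0 HK] := lipG (Num.max M1 M2).
have sab : s0 \in `[a, b].
  by rewrite in_itv/= /a /b ge_min lexx le_max lexx.
have tab : t \in `[a, b].
  by rewrite in_itv/= /a /b ge_min lexx orbT le_max lexx orbT.
have Hd s : s \in `[a, b] -> `|G (w s) - G (v s)| <= K * `|w s - v s|.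
  by move=> sab'; apply: HK; rewrite le_max ?H1 ?H2 ?orbT.
have := gronwall_dist K0 (fun s _ => dw s) (fun s _ => dv s) Hd sab tab.
rewrite E subrr dot0l mulr0 => le0; apply/eqP; rewrite -subr_eq0; apply/eqP.
by apply: dot_eq0; apply/eqP; rewrite eq_le le0 dot_ge0.
Qed.

(* The truncated field agrees with [- G] on the ball of radius [M] and is
   globally Lipschitz. *)
Lemma truncated_lipschitz G M : 0 <= M ->
  (forall M, exists2 K, 0 <= K & forall a b, `|a| <= M -> `|b| <= M ->
     `|G a - G b| <= K * `|a - b|) ->
  exists2 K, 0 < K & forall a b,
     `|- G (clip M a) - - G (clip M b)| <= K * `|a - b|.
Proof.
move=> M0 lipG; have [K K0 HK] := lipG M.
exists (K + 1) => [|a b]; first by rewrite ltr_wpDl.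
rewrite -opprD normrN (le_trans (HK _ _ _ _)) ?norm_clip_le//.
by rewrite ler_pM// ?lerDl// clip_lipschitz.
Qed.

(** Where |w|^2 lies between [rho] and [rho + 1] the truncation is inactive, because
    [rho + 1 <= M ^+ 2], and coercivity with [a0 <= c0 * rho] makes |w|^2 nonincreasing. This strip
    of width 1 is all that [barrier] asks for. *)
Lemma forward_invariant_ball G w (M a0 c0 rho s0 : R) : 0 < c0 ->
  (forall x, c0 * dot x x - a0 <= dot (G x) x) ->
  a0 <= c0 * rho -> rho + 1 <= M ^+ 2 -> 0 <= M ->
  (forall t : R, is_derive t 1 w (- G (clip M (w t)))) ->
  dot (w s0) (w s0) <= rho ->
  forall t, s0 <= t -> dot (w t) (w t) <= rho.
Proof.
move=> c00 coer arho rhoM M0 dw w0 t st.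
have dN (s : R) : is_derive s 1 (fun s => dot (w s) (w s) - rho)
    (2 * dot (- G (clip M (w s))) (w s)).
  have := is_deriveB (is_derive_dot (dw s) (dw s)) (is_derive_cst rho s 1).
  by move=> k; apply: (is_derive_eq k); rewrite subr0 [dot (w s) _]dotC -mulr2n mulr_natl.
rewrite -subr_le0.
apply: (barrier ltr01 (fun s (_ : s \in `[s0, t]) => dN s)); last 2 first.
- move=> s _ /andP[N0 N1].
  have ws : `|w s| <= M.
    rewrite -(ler_sqr (normr_ge0 _)) ?nnegrE// (le_trans (sqr_norm_le_dot _))//.
    by rewrite (le_trans _ rhoM)//; lra.
  rewrite clip_id// dotNl mulrN oppr_le0 mulr_ge0// (le_trans _ (coer _))//.
  rewrite subr_ge0 (le_trans arho)// ler_pM2l//; lra.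
- by rewrite in_itv/= st lexx.
- by rewrite subr_le0.
Qed.

End ODE.

(** * Functions of class C^k of the space variable *)

Section SpatialRegularity.
Context {R : realType} {n : nat}.
Implicit Types (g h : 'rV[R]_n -> R) (x y p a b l : 'rV[R]_n).

Notation e_ i := (delta_mx ord0 i : 'rV[R]_n).

(** The part of [CkT] that survives when time is frozen; the orbit problem lives in the single slice
    t = tau. *)
Fixpoint Ck (k : nat) (g : 'rV[R]_n -> R) : Prop :=
  continuous g /\
  if k is k'.+1 then
    forall i, (forall x, derivable g x (e_ i)) /\ Ck k' (partial i g)
  else True.

Lemma Ck_continuous k g : Ck k g -> continuous g.
Proof. by case: k => [|k] []. Qed.

Lemma CkS k g : Ck k.+1 g -> Ck k g.
Proof.
elim: k g => [|k IH] g [cg H]; first by split.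
by split=> // i; have [dg /IH] := H i.
Qed.

Lemma Ck_partial k g i : Ck k.+1 g -> Ck k (partial i g).
Proof. by move=> [_ H]; have [] := H i. Qed.

Lemma Ck_derivable k g i x : Ck k.+1 g -> derivable g x (e_ i).
Proof. by move=> [_ H]; have [] := H i. Qed.

Lemma continuous_slice T (g : R -> 'rV[R]_n -> R) t : t \in `[0, T] ->
  {within `[0, T] `*` [set: 'rV[R]_n],
     continuous (fun q : R * 'rV[R]_n => g q.1 q.2)} -> continuous (g t).
Proof.
move=> tT cg x.
have Atx : (`[0, T] `*` [set: 'rV[R]_n]) (t, x) by [].
have cgx := (subspace_continuousP _ _).1 cg (t, x) Atx.
apply/continuous_epsdelta => e e0.
have /cvgrPdist_lt /(_ e e0) /nbhs_ballP[d d0 Hd] := cgx.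
exists d => // y xy; apply: (Hd (t, y)); last by [].
by split; [exact: ballxx | rewrite -ball_normE].
Qed.

Lemma CkT_slice T k (g : R -> 'rV[R]_n -> R) t : t \in `[0, T] ->
  CkT T k g -> Ck k (g t).
Proof.
move=> tT; elim: k g => [|k IH] g [cg H]; split=> //;
  try exact: continuous_slice cg.
have [_ {}H] := H; move=> i; have [dg ck] := H i.
by split=> [x|]; [exact: dg | exact: (IH _ ck)].
Qed.

Lemma is_derive_line h x l (s : R) :
  derivable h (x + s *: l) l ->
  is_derive s 1 (fun r => h (x + r *: l)) ('D_l h (x + s *: l)).
Proof.
move=> dh.
have E : (fun r : R => r^-1 *: (h (x + (r *: 1 + s) *: l) - h (x + s *: l)))
       = (fun r : R => r^-1 *: (h (r *: l + (x + s *: l)) - h (x + s *: l))).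
  apply/funext => r; congr (_ *: (h _ - _)).
  by rewrite scalerDl addrCA; congr (_ *: _ + _); rewrite /GRing.scale/= mulr1.
by split; rewrite /derivable /derive /= E.
Qed.

(* Changes the coordinates of [b] into those of [a] one at a time. *)
Lemma telescoping_MVT h p a b (r : R) :
  (forall i x, derivable h x (e_ i)) -> `|a - p| <= r -> `|b - p| <= r ->
  exists z : 'I_n -> 'rV[R]_n, (forall i, `|z i - p| <= r) /\
    h a - h b = \sum_i partial i h (z i) * (a - b) ord0 i.
Proof.
move=> dh ar br.
pose X (k : nat) : 'rV[R]_n := \row_j (if (j < k)%N then a ord0 j else b ord0 j).
have X0 : X 0%N = b by apply/rowP => j; rewrite mxE.
have Xn : X n = a by apply/rowP => j; rewrite mxE ltn_ord.
have coord c q i : `|q - p| <= c -> `|q ord0 i - p ord0 i| <= c.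
  by move=> H; have := coord_le_norm (q - p) i; rewrite !mxE => /le_trans; apply.
have XS (i : 'I_n) : X i.+1 = X i + (a - b) ord0 i *: e_ i.
  apply/rowP => j; rewrite !mxE ltnS leq_eqVlt /=.
  case: (eqVneq j i) => [->|ji].
    by rewrite eqxx ltnn /= mulr1 addrC subrK.
  by rewrite (inj_eq val_inj) (negbTE ji)/= mulr0 addr0.
(* Every coordinate of an intermediate point lies between those of [a] and [b], which for the sup
   norm keeps the point in the ball about [p]. The sign of [d] only orients the segment. *)
have step (i : 'I_n) : exists z : 'rV[R]_n, `|z - p| <= r /\
    h (X i.+1) - h (X i) = partial i h z * (a - b) ord0 i.
  pose d := (a - b) ord0 i.
  have dl (s : R) := is_derive_line (dh i (X i + s *: e_ i)).
  have [d0|d0] := leP 0 d.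
    have [c + E] := MVT_is_derive d0 (fun t _ => dl t).
    rewrite in_itv/= => /andP[c0 cd].
    exists (X i + c *: e_ i); split; last first.
      by rewrite XS -/d -[X in _ - h X]addr0 -(scale0r (e_ i)) E subr0.
    apply: norm_le_coord => [|j]; first exact: le_trans ar.
    rewrite !mxE/=; case: (eqVneq j i) => [->|ji]; last first.
      by rewrite mulr0 addr0; case: ifP => _; exact: coord.
    rewrite ltnn mulr1.
    have := coord _ _ i ar; have := coord _ _ i br.
    move: cd; rewrite /d !mxE !ler_norml => ? /andP[? ?] /andP[? ?].
    by apply/andP; split; lra.
  have [c + E] := MVT_is_derive (ltW d0) (fun t _ => dl t).
  rewrite in_itv/= => /andP[cd c0].
  exists (X i + c *: e_ i); split; last first.
    rewrite XS -/d -opprB -[X in h X - _]addr0 -(scale0r (e_ i)) E sub0r.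
    by rewrite mulrN opprK.
  apply: norm_le_coord => [|j]; first exact: le_trans ar.
  rewrite !mxE/=; case: (eqVneq j i) => [->|ji]; last first.
    by rewrite mulr0 addr0; case: ifP => _; exact: coord.
  rewrite ltnn mulr1.
  have := coord _ _ i ar; have := coord _ _ i br.
  move: cd; rewrite /d !mxE !ler_norml => ? /andP[? ?] /andP[? ?].
  by apply/andP; split; lra.
have /choice [z Hz] := step.
exists z; split=> [i|]; first exact: (Hz i).1.
rewrite -[in LHS]Xn -[in LHS]X0 -(telescope_sumr (fun k => h (X k)) (leq0n n)).
by rewrite big_mkord; apply: eq_bigr => i _; exact: (Hz i).2.
Qed.

(** Between [r *: l + x] and [x], [telescoping_MVT] writes the difference quotient as a combination
    of partial derivatives at points within |r| |l| of [x]; continuity of the partials gives the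
    limit. *)
Lemma is_derive_dir h x l :
  (forall i x, derivable h x (e_ i)) -> (forall i, continuous (partial i h)) ->
  is_derive x l h (\sum_i partial i h x * l ord0 i).
Proof.
move=> dh ch.
suff H : r^-1 *: (h (r *: l + x) - h x) @[r --> 0^'] --> \sum_i partial i h x * l ord0 i.
  by split; [apply/cvg_ex; eexists; exact: H | apply/cvg_lim => //; exact: H].
apply/cvgrPdist_le => e e0.
pose B := \sum_(i < n) `|l ord0 i| + 1.
have B0 : 0 < B by rewrite ltr_wpDl// sumr_ge0.
have [d d0 Hd] := @continuous_epsdelta_fin _ _ _ 'I_n (fun i => partial i h) x
  (fun i => ch i x) _ (divr_gt0 e0 B0).
near=> r.
have r0 : r != 0 by near: r; exact: nbhs_dnbhs_neq.
have rd : `|r| * `|l| < d.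
  have l1 : 0 < `|l| + 1 by rewrite ltr_wpDl.
  rewrite (@le_lt_trans _ _ (`|r| * (`|l| + 1)))//; first by rewrite ler_wpM2l// lerDl.
  by rewrite -ltr_pdivlMr//; near: r; apply: dnbhs0_lt; rewrite divr_gt0.
have ax : `|r *: l + x - x| <= `|r| * `|l| by rewrite addrK normrZ.
have bx : `|x - x| <= `|r| * `|l| by rewrite subrr normr0 mulr_ge0.
have [z [zr ->]] := telescoping_MVT dh ax bx.
rewrite addrK /GRing.scale/= mulr_sumr -sumrB.
apply: (le_trans (ler_norm_sum _ _ _)).
rewrite (@le_trans _ _ (\sum_(i < n) e / B * `|l ord0 i|))//.
  apply: ler_sum => i _; rewrite mxE mulrCA mulKf// -mulrBl normrM ler_wpM2r//.
  by apply/ltW/Hd; rewrite distrC (le_lt_trans (zr i)).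
rewrite -mulr_sumr -mulrA ler_piMr//; first exact: ltW.
by rewrite mulrC ler_pdivrMr// mul1r lerDl.
Unshelve. all: by end_near. Qed.

End SpatialRegularity.

Arguments Ck_partial {R n k g} i _.
Arguments Ck_derivable {R n k g} i x _.

(** * Symmetry of the Hessian, Lipschitz bounds on balls, second-order comparison *)

Section LocalAnalysis.
Context {R : realType} {n : nat}.
Implicit Types (g h : 'rV[R]_n -> R) (x y p a b l d : 'rV[R]_n).

Notation e_ i := (delta_mx ord0 i : 'rV[R]_n).

Lemma norm_delta_le1 (i : 'I_n) : `|e_ i| <= 1.
Proof.
apply: norm_le_coord => // j; rewrite !mxE/=.
by case: (j == i); rewrite ?normr1 ?normr0.
Qed.

(** Mean value theorem in direction [i] for the increment in direction [j], then again in direction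
    [j]. The left-hand side is symmetric in [i] and [j], which is what [schwarz] exploits. *)
Lemma second_difference g i j x (s : R) : Ck 2 g -> 0 < s ->
  exists y, `|x - y| <= 2 * s /\
    g (x + s *: e_ i + s *: e_ j) - g (x + s *: e_ i) - g (x + s *: e_ j) + g x
    = partial j (partial i g) y * s * s.
Proof.
move=> cg s0.
have dN (r : R) : is_derive r 1
    (fun r => g (x + s *: e_ j + r *: e_ i) - g (x + r *: e_ i))
    (partial i g (x + s *: e_ j + r *: e_ i) - partial i g (x + r *: e_ i)).
  have d1 := is_derive_line (Ck_derivable i (x + s *: e_ j + r *: e_ i) cg).
  have d2 := is_derive_line (Ck_derivable i (x + r *: e_ i) cg).
  exact: is_deriveB d1 d2.
have [c c0s E] := MVT_is_derive (ltW s0) (fun t _ => dN t).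
have dM (r : R) := is_derive_line
  (Ck_derivable j (x + c *: e_ i + r *: e_ j) (Ck_partial i cg)).
have [c' c0s' E'] := MVT_is_derive (ltW s0) (fun t _ => dM t).
exists (x + c *: e_ i + c' *: e_ j); split.
  rewrite -addrA opprD addrA subrr add0r normrN.
  rewrite (le_trans (ler_normD _ _))// !normrZ.
  move: c0s c0s'; rewrite !in_itv/= => /andP[c0 cs] /andP[c0' cs'].
  rewrite !ger0_norm// mulr_natl mulr2n lerD//.
    by rewrite (le_trans _ cs)// ler_piMr// norm_delta_le1.
  by rewrite (le_trans _ cs')// ler_piMr// norm_delta_le1.
move: E E'; rewrite !scale0r !addr0 !subr0 => E E'.
have {}E' : partial j (partial i g) (x + c *: e_ i + c' *: e_ j) * s =
    partial i g (x + s *: e_ j + c *: e_ i) - partial i g (x + c *: e_ i).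
  by rewrite (addrAC x (s *: e_ j)) E'.
by rewrite E' -E (addrAC x (s *: e_ i)) opprB addrA [RHS]addrAC.
Qed.

Lemma eq_of_arbitrarily_close (A B : 'rV[R]_n -> R) x :
  continuous A -> continuous B ->
  (forall s, 0 < s -> exists y z, [/\ `|x - y| <= s, `|x - z| <= s & A y = B z]) ->
  A x = B x.
Proof.
move=> cA cB H.
apply/eqP; rewrite -subr_eq0 -normr_le0; apply/ler_addgt0Pr => e e0.
have e2 : 0 < e / 2 by rewrite divr_gt0.
have [d1 d10 H1] := (continuous_epsdelta _ _).1 (cA x) _ e2.
have [d2 d20 H2] := (continuous_epsdelta _ _).1 (cB x) _ e2.
pose s := Num.min d1 d2 / 2.
have s0 : 0 < s by rewrite divr_gt0// lt_min d10.
have sd1 : s < d1 by rewrite /s; case: (leP d1 d2) => ?; lra.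
have sd2 : s < d2 by rewrite /s; case: (leP d1 d2) => ?; lra.
have [y [z [xy xz yz]]] := H _ s0.
have K1 := H1 y (le_lt_trans xy sd1).
have K2 := H2 z (le_lt_trans xz sd2).
rewrite add0r -(subrKA (A y)) (le_trans (ler_normD _ _))// [leRHS]splitr.
by rewrite lerD ?(ltW K1)// yz distrC ltW.
Qed.

Lemma schwarz g i j x : Ck 2 g ->
  partial j (partial i g) x = partial i (partial j g) x.
Proof.
move=> cg.
have c1 := Ck_continuous (Ck_partial j (Ck_partial i cg)).
have c2 := Ck_continuous (Ck_partial i (Ck_partial j cg)).
apply: (eq_of_arbitrarily_close c1 c2) => s s0.
have s2 : 0 < s / 2 by rewrite divr_gt0.
have s2E : 2 * (s / 2) = s by field.
have [y] := second_difference i j x cg s2.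
have [z] := second_difference j i x cg s2.
rewrite s2E (addrAC x).
move: (partial j (partial i g)) (partial i (partial j g)) => A B.
move: (g _) (g _) (g _) (g _) => g1 g2 g3 g4 [xz Ez] [xy Ey].
exists y, z; split=> //.
apply: (mulIf (lt0r_neq0 s2)); apply: (mulIf (lt0r_neq0 s2)).
by rewrite -Ey -Ez addrAC [in RHS]addrAC; ring.
Qed.

Lemma continuous_bounded_ball h (M : R) : continuous h ->
  exists2 K, 0 <= K & forall x, `|x| <= M -> `|h x| <= K.
Proof.
move=> ch.
pose B := [set x : 'rV[R]_n | `|x| <= M].
have cB : compact B.
  apply: bounded_closed_compact.
    by exists M; split; [exact: num_real | move=> N MN x /= /le_trans; apply; exact: ltW].
  have -> : B = (fun x : 'rV[R]_n => `|x|) @^-1` [set r | r <= M] by [].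
  apply: closed_comp; first by move=> x _; exact: norm_continuous.
  exact: closed_le.
have chB : {within B, continuous h} by exact: continuous_subspaceT.
have [K [_ HK]] := compact_bounded (continuous_compact chB cB).
exists (`|K| + 1) => [|x xB]; first by rewrite addr_ge0.
apply: (HK (`|K| + 1)); last by exists x.
by rewrite (le_lt_trans (ler_norm _))// ltrDl.
Qed.

Lemma Ck1_lipschitz_ball h (M : R) : Ck 1 h ->
  exists2 K, 0 <= K & forall a b, `|a| <= M -> `|b| <= M ->
    `|h a - h b| <= K * `|a - b|.
Proof.
move=> ch.
have /choice [K HK] : forall i, exists K, 0 <= K /\
    forall x, `|x| <= M -> `|partial i h x| <= K.
  move=> i; have [K ? ?] := @continuous_bounded_ball (partial i h) M
    (Ck_continuous (Ck_partial i ch)).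
  by exists K.
exists (\sum_i K i) => [|a b aM bM]; first by apply: sumr_ge0 => i _; exact: (HK i).1.
have aM0 : `|a - 0| <= M by rewrite subr0.
have bM0 : `|b - 0| <= M by rewrite subr0.
have [z [zM ->]] := telescoping_MVT (fun i x => Ck_derivable i x ch) aM0 bM0.
rewrite (le_trans (ler_norm_sum _ _ _))// mulr_suml; apply: ler_sum => i _.
rewrite normrM ler_pM//; last exact: coord_le_norm.
by apply: (HK i).2; have := zM i; rewrite subr0.
Qed.

Lemma Ck_lincomb m k (c : 'I_m -> R) (q : 'I_m -> 'rV[R]_n -> R) :
  (forall i, Ck k (q i)) -> Ck k (fun x => \sum_i c i * q i x).
Proof.
elim: k q => [|k IH] q Hq.
  by split=> //; apply: continuous_lincomb => i; exact: Ck_continuous (Hq i).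
split; first by apply: continuous_lincomb => i; exact: Ck_continuous (Hq i).
move=> j.
have D x : is_derive x (e_ j) (fun x => \sum_i c i * q i x)
    (\sum_i c i * partial j (q i) x).
  apply: is_derive_lincomb => i; apply: derivableP; exact: Ck_derivable (Hq i).
split=> [x|]; first by have [] := D x.
rewrite (_ : partial j _ = fun x => \sum_i c i * partial j (q i) x).
  by apply: IH => i; exact: Ck_partial.
by apply/funext => x; rewrite /partial; have [_ ->] := D x.
Qed.

Lemma partial_lincomb m k j (c : 'I_m -> R) (q : 'I_m -> 'rV[R]_n -> R) x :
  (forall i, Ck k.+1 (q i)) ->
  partial j (fun x => \sum_i c i * q i x) x = \sum_i c i * partial j (q i) x.
Proof.
move=> Hq.
have [_ <-//] : is_derive x (e_ j) (fun x => \sum_i c i * q i x)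
    (\sum_i c i * partial j (q i) x).
by apply: is_derive_lincomb => i; apply: derivableP; exact: Ck_derivable (Hq i).
Qed.

(** Integrating the bound twice: first [dN] against 2 c t, then [N] against c t^2. For negative t
    the first inequality reverses, and integrating leftwards reverses it back. *)
Lemma second_order_le (N dN ddN : R -> R) (c r : R) :
  (forall t : R, is_derive t 1 N (dN t)) ->
  (forall t : R, is_derive t 1 dN (ddN t)) ->
  N 0 = 0 -> dN 0 = 0 -> (forall t, `|t| <= r -> ddN t <= 2 * c) ->
  forall t, `|t| <= r -> N t <= c * t ^+ 2.
Proof.
move=> d1 d2 N0 dN0 H t tr.
have dA (s : R) : is_derive s 1 (fun s => dN s - 2 * c * s) (ddN s - 2 * c).
  have k := is_deriveB (d2 s) (is_derive_mulr (is_derive_cst (2 * c) s 1)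
    (is_derive_id s 1)).
  by apply: (is_derive_eq k); rewrite mulr0 addr0 mulr1.
have dB (s : R) : is_derive s 1 (fun s => N s - c * (s * s)) (dN s - 2 * c * s).
  have k := is_deriveB (d1 s) (is_derive_mulr (is_derive_cst c s 1)
    (is_derive_mulr (is_derive_id s 1) (is_derive_id s 1))).
  by apply: (is_derive_eq k); rewrite /cst; ring.
rewrite ler_norml in tr; move/andP: tr => [rt tr].
have [t0|t0] := leP 0 t.
  have A s : 0 <= s -> s <= t -> dN s - 2 * c * s <= 0.
    move=> s0 st.
    have := nonincreasing_is_derive s0 (fun u _ => dA u).
    rewrite dN0 mulr0 subr0; apply => u; rewrite in_itv/= => /andP[u0 us].
    by rewrite subr_le0 H// ler_norml; apply/andP; split; lra.
  have := nonincreasing_is_derive t0 (fun u _ => dB u).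
  rewrite N0 !mulr0 subr0 subr_le0 expr2; apply => u.
  by rewrite in_itv/= => /andP[u0 us]; exact: A.
have A s : t <= s -> s <= 0 -> 0 <= dN s - 2 * c * s.
  move=> ts s0.
  have := nonincreasing_is_derive s0 (fun u _ => dA u).
  rewrite dN0 mulr0 subr0; apply => u; rewrite in_itv/= => /andP[u0 us].
  by rewrite subr_le0 H// ler_norml; apply/andP; split; lra.
have := nondecreasing_is_derive (ltW t0) (fun u _ => dB u).
rewrite N0 !mulr0 subr0 subr_le0 expr2; apply => u.
by rewrite in_itv/= => /andP[u0 us]; exact: A.
Qed.

End LocalAnalysis.

(** * Semidefinite forms with a one-dimensional kernel *)

Section Gap.
Context {R : realType} {n : nat}.
Implicit Types (u v w l : 'rV[R]_n) (S A : 'M[R]_n).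

Lemma dot_mulmx_sym S u v : S^T = S -> dot u (v *m S) = dot v (u *m S).
Proof.
move=> ST; have E (x y : 'rV[R]_n) : dot x y = (x *m y^T) ord0 ord0.
  by rewrite mxE; apply: eq_bigr => i _; rewrite mxE.
by rewrite dotC !E trmx_mul ST mulmxA.
Qed.

Lemma psd_cauchy_schwarz S u v : S^T = S ->
  (forall w, 0 <= dot w (w *m S)) ->
  dot u (v *m S) ^+ 2 <= dot u (u *m S) * dot v (v *m S).
Proof.
move=> ST P.
have Q (t : R) : 0 <= dot u (u *m S) + 2 * t * dot u (v *m S) + t ^+ 2 * dot v (v *m S).
  have := P (u + t *: v).
  rewrite mulmxDl -scalemxAl !dotDl !dotDr !dotZl !dotZr.
  by rewrite (dot_mulmx_sym v u ST) => /le_trans; apply; rewrite le_eqVlt; apply/orP; left;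
    apply/eqP; ring.
move: (P u) (P v) Q; move: (dot u (u *m S)) (dot v (v *m S)) (dot u (v *m S)).
move=> a c b a0 c0 Q.
have [c00|cn0] := eqVneq c 0.
  have [b0|bn0] := eqVneq b 0; first by rewrite b0 c00 expr2 !mulr0.
  (* With c = 0 the quadratic in t is affine, and this t gives it the value -1. *)
  have := Q (- (a + 1) / (2 * b)); rewrite c00 mulr0 addr0.
  have -> : 2 * (- (a + 1) / (2 * b)) * b = - (a + 1) by field.
  by lra.
have cp : 0 < c by rewrite lt_neqAle eq_sym cn0.
have := Q (- b / c).
have -> : a + 2 * (- b / c) * b + (- b / c) ^+ 2 * c = (a * c - b ^+ 2) / c by field.
by rewrite pmulr_lge0 ?invr_gt0// subr_ge0.
Qed.

(** Cauchy-Schwarz against [u := v *m S] has the square of |v S|^2 on the left and 0 on the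
    right. *)
Lemma psd_isotropic S v : S^T = S -> (forall w, 0 <= dot w (w *m S)) ->
  dot v (v *m S) = 0 -> v *m S = 0.
Proof.
move=> ST P v0; apply: dot_eq0.
have := psd_cauchy_schwarz (v *m S) v ST P; rewrite v0 mulr0 => H.
by apply/eqP; rewrite -sqrf_eq0 eq_le H sqr_ge0.
Qed.

Lemma mulmx_norm_le (S : 'M[R]_n) :
  exists2 K, 0 <= K & forall v, `|v *m S| <= K * `|v|.
Proof.
exists (\sum_j n%:R * `|(col j S)^T|) => [|v].
  by apply: sumr_ge0 => j _; rewrite mulr_ge0.
apply: norm_le_coord => [|j].
  by rewrite mulr_ge0//; apply: sumr_ge0 => j _; rewrite mulr_ge0.
have -> : (v *m S) ord0 j = dot v (col j S)^T.
  by rewrite mxE; apply: eq_bigr => i _; rewrite !mxE.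
rewrite (le_trans (norm_dot_le _ _))// mulrAC ler_wpM2r//.
by rewrite (bigD1 j)//= lerDl; apply: sumr_ge0 => k _; rewrite mulr_ge0.
Qed.

(* The rank-one perturbation [S + l^T l] is positive definite, hence
   invertible; Cauchy-Schwarz for its form then bounds it below. *)
Lemma psd_gap S l : S^T = S -> (forall w, 0 <= dot w (w *m S)) ->
  dot l l = 1 -> l *m S = 0 ->
  (forall v, v *m S = 0 -> exists c, v = c *: l) ->
  exists2 lam, 0 < lam &
    forall v, lam * (dot v v - dot v l ^+ 2) <= dot v (v *m S).
Proof.
move=> ST P l1 lS ker.
pose B := S + l^T *m l.
have BT : B^T = B by rewrite /B linearD/= trmx_mul trmxK ST.
have vB v : v *m B = v *m S + dot v l *: l.
  rewrite /B mulmxDr mulmxA; congr (_ + _).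
  rewrite [v *m _]mx11_scalar mul_scalar_mx; congr (_ *: _).
  by rewrite mxE; apply: eq_bigr => i _; rewrite mxE.
have vBv v : dot v (v *m B) = dot v (v *m S) + dot v l ^+ 2.
  by rewrite vB dotDr dotZr expr2.
have PB v : 0 <= dot v (v *m B) by rewrite vBv addr_ge0 ?sqr_ge0.
have Bu : B \in unitmx.
  rewrite -row_free_unit -kermx_eq0 -submx0.
  apply/rV_subP => v /sub_kermxP vB0.
  have := vBv v; rewrite vB0 dotC dot0l => /esym/eqP.
  rewrite paddr_eq0 ?sqr_ge0// sqrf_eq0 => /andP[/eqP vS /eqP vl].
  have [c vE] := ker v (psd_isotropic ST P vS).
  move: vl; rewrite vE dotZl l1 mulr1 => ->.
  by rewrite scale0r sub0mx.
have [K K0 HK] := mulmx_norm_le (invmx B).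
pose C : R := n%:R * K + 1.
have C0 : 0 < C by rewrite ltr_wpDl// mulr_ge0.
(* With w = y B^-1, Cauchy-Schwarz for the form of B gives (y.y)^2 <= (y.yB)(w.y), and w.y <= C y.y
   because B^-1 is bounded; one factor y.y cancels. *)
have main y : dot y y <= C * dot y (y *m B).
  pose w := y *m invmx B.
  have wB : w *m B = y by rewrite mulmxKV.
  have CS := psd_cauchy_schwarz y w BT PB.
  rewrite wB in CS.
  have wy : dot w y <= C * dot y y.
    rewrite (le_trans (ler_norm _))// (le_trans (norm_dot_le _ _))//.
    rewrite (@le_trans _ _ (n%:R * K * `|y| ^+ 2))//.
      rewrite expr2 [leRHS]mulrA; apply: ler_wpM2r => //.
      by rewrite -mulrA; apply: ler_wpM2l => //; exact: HK.
    rewrite ler_pM ?mulr_ge0 ?exprn_ge0//; last exact: sqr_norm_le_dot.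
    by rewrite lerDl.
  have [y0|yn0] := eqVneq (dot y y) 0; first by rewrite y0 mulr_ge0// ltW.
  have yp : 0 < dot y y by rewrite lt_neqAle eq_sym yn0 dot_ge0.
  rewrite -(ler_pM2r yp) -expr2 (le_trans CS)//.
  by rewrite -[leRHS]mulrA mulrCA; apply: ler_wpM2l.
exists C^-1 => [|v]; first by rewrite invr_gt0.
rewrite mulrC ler_pdivrMr// mulrC.
(* On the part of [v] orthogonal to [l], the form of B takes the value that the form of S takes at
   [v]. *)
pose y := v - dot v l *: l.
have yl : dot y l = 0 by rewrite /y dotBl dotZl l1 mulr1 subrr.
have yS : y *m S = v *m S by rewrite /y mulmxBl -scalemxAl lS scaler0 subr0.
have lvS : dot l (v *m S) = 0 by rewrite (dot_mulmx_sym _ _ ST) lS dotC dot0l.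
have := main y; rewrite vBv yl expr0n/= addr0 yS {2 3}/y.
rewrite !dotBl !dotZl lvS mulr0 subr0 dotBr dotZr.
by rewrite [dot l y]dotC yl mulr0 subr0 -expr2.
Qed.

End Gap.

(** * The local cone estimates *)

Section Cone.
Context {R : realType} {n : nat}.
Implicit Types (g h : 'rV[R]_n -> R) (x y p a b l d xi : 'rV[R]_n).

Notation e_ i := (delta_mx ord0 i : 'rV[R]_n).

Lemma dot_orthogonal_part d l : dot l l = 1 ->
  dot (d - dot d l *: l) (d - dot d l *: l) = dot d d - dot d l ^+ 2.
Proof.
move=> l1; rewrite !dotBl !dotBr !dotZl !dotZr l1 [dot l d]dotC; ring.
Qed.

(* Along the line [xi + u l] the function [h] is at most a negative multiple of
   [u ^ 2]; in a narrow cone around that line the correction is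
   [O(theta u ^ 2)], because the gradient of [h] vanishes at [xi]. *)
Lemma negative_in_cone h xi l : Ck 2 h -> h xi = 0 ->
  (forall j, partial j h xi = 0) ->
  \sum_j (\sum_k partial k (partial j h) xi * l ord0 k) * l ord0 j < 0 ->
  dot l l = 1 ->
  exists th r ka, [/\ 0 < th, 0 < r, 0 < ka & forall x, `|x - xi| <= r ->
    dot (x - xi) (x - xi) <= (1 + th ^+ 2) * dot (x - xi) l ^+ 2 ->
    h x <= - ka * dot (x - xi) l ^+ 2].
Proof.
move=> ch hxi dhxi; set q := (X in X < 0) => q0 l1.
pose D1 x := \sum_j partial j h x * l ord0 j.
pose D2 x := \sum_j (\sum_k partial k (partial j h) x * l ord0 k) * l ord0 j.
have l1' := norm_unit_le1 l1.
have dl1 x : is_derive x l h (D1 x).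
  apply: is_derive_dir => [i y|i]; first exact: Ck_derivable ch.
  exact: Ck_continuous (Ck_partial i ch).
have dl2 x : is_derive x l D1 (D2 x).
  have H j : is_derive x l (partial j h) (\sum_k partial k (partial j h) x * l ord0 k).
    have cj := Ck_partial j ch.
    apply: is_derive_dir => [i y|i]; first exact: Ck_derivable cj.
    exact: Ck_continuous (Ck_partial i cj).
  have := is_derive_lincomb (fun j => l ord0 j) H.
  rewrite (_ : (fun y => _) = D1); last first.
    by apply/funext => y; apply: eq_bigr => j _; rewrite mulrC.
  by move=> k; apply: (is_derive_eq k); apply: eq_bigr => j _; rewrite mulrC.
have cD2 : continuous D2.
  rewrite (_ : D2 = fun x => \sum_j l ord0 j *
      (\sum_k l ord0 k * partial k (partial j h) x)); last first.
    apply/funext => x; apply: eq_bigr => j _; rewrite mulrC; congr (_ * _).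
    by apply: eq_bigr => k _; rewrite mulrC.
  apply: continuous_lincomb => j; apply: continuous_lincomb => k.
  exact: Ck_continuous (Ck_partial k (Ck_partial j ch)).
have dN (u : R) : is_derive u 1 (fun u => h (xi + u *: l)) (D1 (xi + u *: l)).
  have [? <-] := dl1 (xi + u *: l).
  exact: is_derive_line.
have dN2 (u : R) : is_derive u 1 (fun u => D1 (xi + u *: l)) (D2 (xi + u *: l)).
  have [? <-] := dl2 (xi + u *: l).
  exact: is_derive_line.
have q2 : 0 < - q / 2 by lra.
have [r2 r20 Hr2] := (continuous_epsdelta _ _).1 (cD2 xi) _ q2.
have line u : `|u| <= r2 / 2 -> h (xi + u *: l) <= q / 4 * u ^+ 2.
  apply: (second_order_le dN dN2).
  - by rewrite scale0r addr0.
  - by rewrite scale0r addr0; rewrite /D1 big1// => j _; rewrite dhxi mul0r.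
  - move=> t tr.
    have : `|xi - (xi + t *: l)| < r2.
      rewrite opprD addrA subrr add0r normrN normrZ.
      rewrite (@le_lt_trans _ _ `|t|)//; first by rewrite ler_piMr.
      lra.
    move=> /Hr2; have -> : D2 xi = q by [].
    move: (D2 (xi + t *: l)) => z K.
    have := ler_norm (- (q - z)); rewrite normrN.
    by move: (q) K => q' K; lra.
pose M := `|xi| + 1.
have /choice [K HK] : forall j, exists K, 0 <= K /\ forall a b, `|a| <= M ->
    `|b| <= M -> `|partial j h a - partial j h b| <= K * `|a - b|.
  by move=> j; have [K ? ?] := Ck1_lipschitz_ball M (Ck_partial j ch); exists K.
pose KK := \sum_j K j.
have KK0 : 0 <= KK by apply: sumr_ge0 => j _; exact: (HK j).1.
(* The bound on the line is - 2 ka u^2; half of it is kept for leaving the line. That costs at most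
   KK (2|u|)(th |u|), so [th] is chosen with 2 KK th <= ka, and th <= 1 ensures |d| <= 2|u| in the
   cone. *)
pose ka := - q / 8.
have ka0 : 0 < ka by rewrite /ka; lra.
pose th := Num.min 1 (ka / (2 * KK + 1)).
have th0 : 0 < th by rewrite lt_min ltr01 divr_gt0//; lra.
have th1 : th <= 1 by rewrite ge_min lexx.
have thK : 2 * KK * th <= ka.
  have : th <= ka / (2 * KK + 1) by rewrite ge_min lexx orbT.
  rewrite ler_pdivlMr; last by lra.
  by apply: le_trans; rewrite mulrDr mulr1 mulrC; lra.
(* As |u| <= n |d|, dividing by n + 1 forces |u| <= 1/2, so that points within 2|u| of [xi] stay in
   the ball of radius [M], and |u| <= r2/2, as the bound on the line requires. *)
pose r := Num.min (2^-1) (r2 / 2) / (n%:R + 1).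
have n1 : 0 < n%:R + 1 :> R by rewrite ltr_wpDl.
have r0 : 0 < r by rewrite divr_gt0// lt_min; apply/andP; split; lra.
exists th, r, ka; split=> // x xr.
set d := x - xi in xr *; set u := dot d l => cone.
have ur : `|u| <= Num.min (2^-1) (r2 / 2).
  rewrite (le_trans (norm_dot_le _ _))//.
  rewrite (@le_trans _ _ ((n%:R + 1) * r))//; last first.
    by rewrite /r mulrCA mulfV ?gt_eqF// mulr1.
  rewrite (@le_trans _ _ (n%:R * `|d|))//; first by rewrite ler_piMr// mulr_ge0.
  by rewrite ler_pM// lerDl.
have ur1 : `|u| <= 2^-1 by rewrite (le_trans ur)// ge_min lexx.
have ur2 : `|u| <= r2 / 2 by rewrite (le_trans ur)// ge_min lexx orbT.
have u2 : `|u| ^+ 2 = u ^+ 2 by rewrite real_normK// num_real.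
have d2u : `|d| <= 2 * `|u|.
  rewrite -(ler_sqr (normr_ge0 _)) ?nnegrE ?mulr_ge0// exprMn u2.
  rewrite (le_trans (sqr_norm_le_dot _))// (le_trans cone)//.
  rewrite ler_wpM2r ?sqr_ge0//.
  have : th ^+ 2 <= 1 by rewrite exprn_ile1// ltW.
  lra.
have ydot : dot (d - u *: l) (d - u *: l) <= (th * `|u|) ^+ 2.
  rewrite (dot_orthogonal_part d l1) -/u exprMn u2 lerBlDr.
  by rewrite -[X in _ + X]mul1r -mulrDl addrC.
have yu : `|d - u *: l| <= th * `|u|.
  rewrite -(ler_sqr (normr_ge0 _)) ?nnegrE ?mulr_ge0 ?(ltW th0)//.
  exact: le_trans (sqr_norm_le_dot _) ydot.
have ax : `|x - xi| <= 2 * `|u| by exact: d2u.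
have bx : `|xi + u *: l - xi| <= 2 * `|u|.
  rewrite addrAC subrr add0r normrZ (@le_trans _ _ `|u|)//.
    by rewrite ler_piMr.
  by have := normr_ge0 u; lra.
have [z [zr Ez]] := telescoping_MVT (fun i x => Ck_derivable i x ch) ax bx.
have yE : x - (xi + u *: l) = d - u *: l by rewrite /d opprD addrA.
have inM y : `|y - xi| <= 1 -> `|y| <= M.
  move=> H; rewrite -(subrK xi y) (le_trans (ler_normD _ _))// /M addrC.
  by rewrite lerD2l.
have bound : h x - h (xi + u *: l) <= ka * u ^+ 2.
  rewrite Ez yE (le_trans (ler_norm _))// (le_trans (ler_norm_sum _ _ _))//.
  rewrite (@le_trans _ _ (\sum_i K i * (2 * `|u|) * (th * `|u|)))//.
    apply: ler_sum => i _; rewrite normrM ler_pM//.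
      have u1 : 2 * `|u| <= 1 by lra.
      have := (HK i).2 (z i) xi (inM _ (le_trans (zr i) u1)).
      rewrite dhxi subr0 => /(_ ltac:(rewrite /M; lra)) /le_trans; apply.
      by rewrite ler_wpM2l// (HK i).1.
    exact: le_trans (coord_le_norm _ _) yu.
  rewrite -!mulr_suml -/KK -u2 expr2.
  have -> : KK * (2 * `|u|) * (th * `|u|) = 2 * KK * th * (`|u| * `|u|) by ring.
  by rewrite ler_wpM2r// mulr_ge0.
have := line u ur2.
have : q / 4 * u ^+ 2 + ka * u ^+ 2 = - ka * u ^+ 2 by rewrite /ka; field.
lra.
Qed.

(* The factor in the scalar product is half the gradient at [d] of
   [dot d d - m * dot d l ^ 2], the function defining the cone. *)
Lemma gradient_monotone_outside_cone g xi l (th : R) : Ck 2 g -> 0 < th ->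
  possemidef (hessian g xi) -> dot l l = 1 ->
  (kermx (hessian g xi)^T == l)%MS ->
  exists r mu, [/\ 0 < r, 0 < mu & forall a b,
    `|a - xi| <= r -> `|b - xi| <= r ->
    (1 + th ^+ 2) * dot (a - b) l ^+ 2 <= dot (a - b) (a - b) ->
    mu * dot (a - b) (a - b) <=
      dot (a - b - ((1 + th ^+ 2) * dot (a - b) l) *: l) (grad g a - grad g b)].
Proof.
move=> cg th0 psd l1 /andP[kerl lker].
pose S := (hessian g xi)^T.
have ST : S^T = S.
  by apply/matrixP => i j; rewrite !mxE; exact: schwarz.
have lS : l *m S = 0 by apply/sub_kermxP.
have kS v : v *m S = 0 -> exists c, v = c *: l.
  move=> /sub_kermxP vk; have /sub_rVP [c ->] := submx_trans vk kerl.
  by exists c.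
have [lam lam0 gap] := psd_gap ST psd l1 lS kS.
pose m := 1 + th ^+ 2.
have m1 : 1 < m by rewrite /m ltrDl exprn_gt0.
have m0 : 0 < m by lra.
(* Half of the rate lam th^2 / m obtained from S alone; the other half absorbs the oscillation [eta]
   of the Hessian. *)
pose mu := lam * th ^+ 2 / (2 * m).
have mu0 : 0 < mu by rewrite divr_gt0 ?mulr_gt0 ?exprn_gt0.
(* One factor [n] from the scalar product, 1 + m n from the vector d - m u l, another [n] from the
   error [E]; the final 1 ensures positivity. *)
pose CC := n%:R * (1 + m * n%:R) * n%:R + 1 : R.
have CC0 : 0 < CC by rewrite ltr_wpDl// !mulr_ge0// addr_ge0// mulr_ge0// ltW.
pose eta := mu / CC.
have eta0 : 0 < eta by rewrite divr_gt0.
have cc (ij : 'I_n * 'I_n) : {for xi, continuous (partial ij.2 (partial ij.1 g))}.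
  exact: (Ck_continuous (Ck_partial ij.2 (Ck_partial ij.1 cg))).
have [r r0 Hr] := continuous_epsdelta_fin cc eta0.
have r20 : 0 < r / 2 by rewrite divr_gt0.
exists (r / 2), mu; split=> // a b ar br.
set d := a - b; set u := dot d l => cone.
pose E := grad g a - grad g b - d *m S.
have EE i : `|E ord0 i| <= n%:R * eta * `|d|.
  have [z [zr Ez]] := telescoping_MVT
     (fun k x => Ck_derivable k x (Ck_partial i cg)) ar br.
  rewrite !mxE Ez -sumrB (le_trans (ler_norm_sum _ _ _))//.
  rewrite -mulrA mulr_natl.
  rewrite -[leRHS](_ : \sum_(k < n) eta * `|d| = _); last by rewrite sumr_const card_ord.
  apply: ler_sum => k _; rewrite !mxE -/(d ord0 k).
  have -> : a ord0 k - b ord0 k = d ord0 k by rewrite !mxE.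
  rewrite [X in _ - X]mulrC -mulrBl normrM ler_pM ?coord_le_norm// distrC.
  by apply/ltW/(Hr (i, k)); rewrite distrC (le_lt_trans (zr k))//; lra.
have EN : `|E| <= n%:R * eta * `|d|.
  have e0 := ltW eta0.
  by apply: norm_le_coord EE; rewrite mulr_ge0// mulr_ge0.
have -> : grad g a - grad g b = d *m S + E by rewrite /E [RHS]addrC subrK.
clearbody d E; rewrite -/m in cone *.
rewrite dotDr.
have lSd : dot l (d *m S) = 0 by rewrite (dot_mulmx_sym _ _ ST) lS dotC dot0l.
(* Since S l = 0 the left factor may be replaced by [d], and the gap applies. The condition m u^2 <=
   |d|^2 turns |d|^2 - u^2 into at least (th^2 / m) |d|^2. *)
have part1 : lam * th ^+ 2 / m * dot d d <= dot (d - (m * u) *: l) (d *m S).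
  rewrite dotBl dotZl lSd mulr0 subr0 (le_trans _ (gap d))// -/u.
  rewrite mulrAC ler_pdivrMr// -[leLHS]mulrA -[leRHS]mulrA ler_pM2l//.
  have -> : (dot d d - u ^+ 2) * m = th ^+ 2 * dot d d + (dot d d - m * u ^+ 2).
    by rewrite /m; ring.
  by rewrite lerDl subr_ge0.
have part2 : `|dot (d - (m * u) *: l) E| <= mu * dot d d.
  rewrite (le_trans (norm_dot_le _ _))//.
  have N1 : `|d - (m * u) *: l| <= (1 + m * n%:R) * `|d|.
    rewrite (le_trans (ler_normB _ _))// [leRHS]mulrDl mul1r lerD2l normrZ normrM.
    rewrite (gtr0_norm m0) -[leLHS]mulrA -[leRHS]mulrA ler_pM2l//.
    have l1' := norm_unit_le1 l1.
    rewrite (@le_trans _ _ `|u|)//; first by rewrite ler_piMr.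
    by rewrite (le_trans (norm_dot_le _ _))// ler_piMr// mulr_ge0.
  rewrite (@le_trans _ _ (n%:R * ((1 + m * n%:R) * `|d|) * (n%:R * eta * `|d|)))//.
    by apply: ler_pM => //; apply: ler_wpM2l.
  rewrite (@le_trans _ _ (CC * eta * `|d| ^+ 2))//; last first.
    have -> : CC * eta = mu by rewrite /eta mulrC divfK// gt_eqF.
    by rewrite ler_pM2l// sqr_norm_le_dot.
  have -> : n%:R * ((1 + m * n%:R) * `|d|) * (n%:R * eta * `|d|) =
      n%:R * (1 + m * n%:R) * n%:R * (eta * `|d| ^+ 2) by ring.
  rewrite -[leRHS]mulrA; apply: ler_wpM2r; last by rewrite /CC lerDl.
  by rewrite mulr_ge0 ?exprn_ge0// ltW.
have := ler_norm (- dot (d - (m * u) *: l) E); rewrite normrN.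
have -> : mu * dot d d = lam * th ^+ 2 / m * dot d d - mu * dot d d.
  by rewrite /mu; field; rewrite gt_eqF.
lra.
Qed.

End Cone.

(** * The cone estimates at the degenerate critical point *)

Section LocalStructure.
Context {R : realType} {n : nat}.
Implicit Types (g h : 'rV[R]_n -> R) (x y p a b l d xi : 'rV[R]_n).

Lemma third_formZ g xi l (c : R) :
  third_form g xi (c *: l) = c ^+ 3 * third_form g xi l.
Proof.
rewrite /third_form !mulr_sumr; apply: eq_bigr => i _.
rewrite !mulr_sumr; apply: eq_bigr => j _.
rewrite !mulr_sumr; apply: eq_bigr => k _.
rewrite !mxE; move: (partial _ _ _) => z; ring.
Qed.

(** Condenses the hypotheses at [xi] into two inequalities, one outside and one inside a cone. The
    local analysis of orbits uses the derivatives of [g] beyond the gradient only through them and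
    through Lipschitz bounds. *)
Lemma saddle_node_cone g xi l0 : Ck 3 g -> grad g xi = 0 ->
  possemidef (hessian g xi) -> l0 <> 0 ->
  (kermx (hessian g xi)^T == l0)%MS -> third_form g xi l0 <> 0 ->
  exists (l : 'rV[R]_n) (m r mu ka : R),
  [/\ dot l l = 1, 1 <= m, [/\ 0 < r, 0 < mu & 0 < ka],
      forall a b, `|a - xi| <= r -> `|b - xi| <= r ->
        m * dot (a - b) l ^+ 2 <= dot (a - b) (a - b) ->
        mu * dot (a - b) (a - b) <=
          dot (a - b - (m * dot (a - b) l) *: l) (grad g a - grad g b)
    & forall x, `|x - xi| <= r ->
        dot (x - xi) (x - xi) <= m * dot (x - xi) l ^+ 2 ->
        dot (grad g x) l <= - ka * dot (x - xi) l ^+ 2].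
Proof.
move=> cg g0 psd /eqP l00 ker0 third0.
pose s : R := Num.sqrt (dot l0 l0).
have s0 : 0 < s by rewrite sqrtr_gt0 dot_gt0.
have s2 : s ^+ 2 = dot l0 l0 by rewrite sqr_sqrtr// dot_ge0.
have [l [l1 kerl third]] : exists l, [/\ dot l l = 1,
    (kermx (hessian g xi)^T == l)%MS & third_form g xi l < 0].
  (* The cubic form is odd, so the sign in [c] can make it negative; dividing by [s] makes the
     vector a unit vector. *)
  pose c : R := - Num.sg (third_form g xi l0) / s.
  have sg2 : Num.sg (third_form g xi l0) ^+ 2 = 1 by rewrite sqr_sg; case: eqP.
  have c2 : c ^+ 2 = (s ^+ 2)^-1 by rewrite /c expr_div_n sqrrN sg2 div1r.
  have cn0 : c != 0 by rewrite -sqrf_eq0 c2 invr_eq0 sqrf_eq0 gt_eqF.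
  exists (c *: l0); split.
  - by rewrite dotZl dotZr mulrA -expr2 c2 -s2 mulVf// sqrf_eq0 gt_eqF.
  - by rewrite !(eqmx_scale _ cn0).
  - rewrite third_formZ exprS c2 /c.
    have -> : - Num.sg (third_form g xi l0) / s / s ^+ 2 * third_form g xi l0 =
      - `|third_form g xi l0| / s ^+ 3.
      rewrite normrEsg; field; by rewrite gt_eqF.
    by rewrite mulNr oppr_lt0 divr_gt0 ?exprn_gt0// normr_gt0; apply/eqP.
(* [h] is the component of the gradient along [l]. Its own gradient at [xi] is the Hessian applied
   to [l], which vanishes, and its second derivative along [l] is the cubic form. *)
pose h x := \sum_i l ord0 i * partial i g x.
have hE x : dot (grad g x) l = h x.
  by apply: eq_bigr => i _; rewrite mxE mulrC.
have ci i := Ck_partial i cg.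
have ch : Ck 2 h by apply: Ck_lincomb => i; exact: ci.
have h1 j : partial j h = fun x => \sum_i l ord0 i * partial j (partial i g) x.
  by apply/funext => x; rewrite (partial_lincomb j (fun i => l ord0 i) x ci).
have h2 k j : partial k (partial j h) xi =
    \sum_i l ord0 i * partial k (partial j (partial i g)) xi.
  rewrite h1; have cij i := Ck_partial j (ci i).
  by rewrite (partial_lincomb k (fun i => l ord0 i) xi cij).
have hxi : h xi = 0 by rewrite -hE g0 dot0l.
have dhxi j : partial j h xi = 0.
  have lk : l *m (hessian g xi)^T = 0.
    by apply/sub_kermxP; have /andP[] := kerl.
  apply: (@etrans _ _ ((l *m (hessian g xi)^T) ord0 j)); last by rewrite lk mxE.
  rewrite h1 [RHS]mxE; apply: eq_bigr => i _; congr (_ * _).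
  rewrite [RHS]mxE [RHS]mxE; exact: (schwarz i j xi (CkS cg)).
have q0 : \sum_j (\sum_k partial k (partial j h) xi * l ord0 k) * l ord0 j < 0.
  suff -> : \sum_j (\sum_k partial k (partial j h) xi * l ord0 k) * l ord0 j =
    third_form g xi l by [].
  rewrite /third_form exchange_big/=; apply: eq_bigr => j _.
  rewrite exchange_big/= mulr_suml; apply: eq_bigr => k _.
  rewrite h2 !mulr_suml; apply: eq_bigr => i _.
  by move: (partial _ _ _) => z; ring.
(* The aperture [th] comes from the cubic term and is then fed to the estimate outside the cone,
   which holds for every positive aperture at the cost of a smaller radius. *)
have [th [r1 [ka [th0 r10 ka0 N]]]] := negative_in_cone ch hxi dhxi q0 l1.
have [r2 [mu [r20 mu0 M]]] := gradient_monotone_outside_cone (CkS cg) th0 psd l1 kerl.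
exists l, (1 + th ^+ 2), (Num.min r1 r2), mu, ka; split=> //.
- by rewrite lerDl sqr_ge0.
- by split=> //; rewrite lt_min r10.
- move=> a b; rewrite !le_min => /andP[_ ar] /andP[_ br]; exact: M.
- by move=> x; rewrite le_min hE => /andP[xr _]; exact: N.
Qed.

End LocalStructure.

(** * Orbits emanating from the stationary point *)

Definition cone_form {R : realType} {n : nat} (m : R) (l d : 'rV[R]_n) : R :=
  dot d d - m * dot d l ^+ 2.

Section Orbits.
Context {R : realType} {n : nat} (G : 'rV[R]_n -> 'rV[R]_n) (xi l : 'rV[R]_n).
Context (m r mu ka : R).
Hypotheses (Gxi : G xi = 0) (l1 : dot l l = 1) (m1 : 1 <= m).
Hypotheses (r0 : 0 < r) (mu0 : 0 < mu) (ka0 : 0 < ka).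
Hypothesis outside : forall a b, `|a - xi| <= r -> `|b - xi| <= r ->
  m * dot (a - b) l ^+ 2 <= dot (a - b) (a - b) ->
  mu * dot (a - b) (a - b) <=
    dot (a - b - (m * dot (a - b) l) *: l) (G a - G b).
Hypothesis inside : forall x, `|x - xi| <= r ->
  dot (x - xi) (x - xi) <= m * dot (x - xi) l ^+ 2 ->
  dot (G x) l <= - ka * dot (x - xi) l ^+ 2.
Hypothesis lipG : forall M, exists2 K, 0 <= K & forall a b, `|a| <= M ->
  `|b| <= M -> `|G a - G b| <= K * `|a - b|.

Notation V := (cone_form m l).

Lemma is_derive_cone_form (a b : R -> 'rV[R]_n) (da db : 'rV[R]_n) (t : R) :
  is_derive t 1 a da -> is_derive t 1 b db ->
  is_derive t 1 (fun s => V (a s - b s))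
    (2 * dot (a t - b t - (m * dot (a t - b t) l) *: l) (da - db)).
Proof.
move=> da_ db_; have dd := is_derive_dist da_ db_.
pose d s := a s - b s.
have dl : is_derive t 1 (fun s => dot (d s) l) (dot (da - db) l).
  have := is_derive_dot dd (is_derive_cst l t 1).
  by move=> k; apply: (is_derive_eq k); rewrite [dot _ 0]dotC dot0l addr0.
have dm := is_derive_mulr (is_derive_cst m t 1) (is_derive_mulr dl dl).
have := is_deriveB (is_derive_dot dd dd) dm.
move=> k; rewrite (_ : (fun s => V _) =
  fun s => dot (d s) (d s) - m * (dot (d s) l * dot (d s) l)).
  apply: (is_derive_eq k); rewrite /d /cst.
  move: (a t - b t) (da - db) => x y.
  rewrite dotBl dotZl.
  by rewrite [dot y x]dotC [dot y l]dotC; ring.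
by apply/funext => s; rewrite /cone_form expr2.
Qed.

Lemma cone_form_decay a b : `|a - xi| <= r -> `|b - xi| <= r ->
  0 <= V (a - b) ->
  2 * dot (a - b - (m * dot (a - b) l) *: l) (- G a - - G b) <= - (2 * mu) * V (a - b).
Proof.
move=> ar br; rewrite subr_ge0 => /(outside ar br) H.
rewrite -opprD dotNr mulrN mulNr lerN2 -mulrA ler_pM2l//.
rewrite (le_trans _ H)// ler_pM2l// /cone_form gerBl mulr_ge0 ?sqr_ge0//.
exact: le_trans m1.
Qed.

Lemma norm_diff_ball a b : `|a - xi| <= r -> `|b - xi| <= r -> `|a - b| <= 2 * r.
Proof.
move=> ar br; rewrite -(subrKA xi) (le_trans (ler_normD _ _))//.
by rewrite [X in _ + X]distrC mulr_natl mulr2n lerD.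
Qed.

(* Where the form is positive it decreases along the flow, at a rate
   proportional to its size: going backward it would become unbounded. *)
Lemma cone_backward (a b : R -> 'rV[R]_n) (s0 : R) :
  (forall s : R, s <= s0 -> is_derive s 1 a (- G (a s))) ->
  (forall s : R, s <= s0 -> is_derive s 1 b (- G (b s))) ->
  (forall s, s <= s0 -> `|a s - xi| <= r) ->
  (forall s, s <= s0 -> `|b s - xi| <= r) ->
  forall s, s <= s0 -> V (a s - b s) <= 0.
Proof.
move=> da db ar br s1 s10; rewrite leNgt; apply/negP => V1.
have dV (s : R) : s <= s0 -> _ := fun ss => is_derive_cone_form (da s ss) (db s ss).
have dVle s : s <= s0 -> 0 <= V (a s - b s) ->
   2 * dot (a s - b s - (m * dot (a s - b s) l) *: l) (- G (a s) - - G (b s))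
     <= - (2 * mu) * V (a s - b s).
  by move=> ss; apply: cone_form_decay; [exact: ar|exact: br].
(* Above the nonnegative level [c] the form cannot increase, so by [barrier] it could not rise from
   [V (a s - b s)] to a larger value at the later time [s1]. *)
have grow s : s <= s1 -> V (a s1 - b s1) <= V (a s - b s).
  move=> ss1; rewrite leNgt; apply/negP => Vlt.
  pose c := Num.max 0 (V (a s - b s)).
  have c0 : 0 <= c by rewrite le_max lexx.
  have c1 : c < V (a s1 - b s1) by rewrite gt_max V1 Vlt.
  have dN (t : R) : t \in `[s, s1] -> is_derive t 1 (fun t => V (a t - b t) - c)
      (2 * dot (a t - b t - (m * dot (a t - b t) l) *: l) (- G (a t) - - G (b t)) - 0).
    rewrite in_itv/= => /andP[_ ts1].
    exact: is_deriveB (dV t (le_trans ts1 s10)) (is_derive_cst c t 1).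
  have := barrier ltr01 dN; rewrite subr_le0 le_max lexx orbT => /(_ isT).
  have Hneg t : t \in `[s, s1] -> 0 < V (a t - b t) - c < 1 ->
      2 * dot (a t - b t - (m * dot (a t - b t) l) *: l) (- G (a t) - - G (b t)) - 0 <= 0.
    rewrite in_itv/= => /andP[_ ts1] /andP[Vt _]; rewrite subr0.
    have Vt0 : 0 <= V (a t - b t) by rewrite (le_trans c0)// ltW// -subr_gt0.
    rewrite (le_trans (dVle t (le_trans ts1 s10) Vt0))//.
    by rewrite mulNr oppr_le0 mulr_ge0// mulr_ge0// ltW.
  move=> /(_ Hneg s1); rewrite in_itv/= ss1 lexx => /(_ isT).
  by rewrite subr_le0 leNgt c1.
pose k := 2 * mu * V (a s1 - b s1).
have k0 : 0 < k by rewrite !mulr_gt0.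
pose B : R := n%:R * (2 * r) ^+ 2.
have B0 : 0 <= B by rewrite mulr_ge0// sqr_ge0.
have Vbound s : s <= s0 -> V (a s - b s) <= B.
  move=> ss; rewrite /cone_form (@le_trans _ _ (dot (a s - b s) (a s - b s)))//.
    by rewrite gerBl mulr_ge0 ?sqr_ge0// (le_trans ler01).
  rewrite (le_trans (dot_le_sqr_norm _))// ler_wpM2l//.
  rewrite ler_sqr ?nnegrE ?mulr_ge0 ?(ltW r0)//.
  exact: norm_diff_ball (ar s ss) (br s ss).
(* Over a time (B + 1)/k a slope of at most -k forces a value above the a priori bound [B] at
   [s2]. *)
pose s2 := s1 - (B + 1) / k.
have s21 : s2 <= s1 by rewrite gerBl divr_ge0 ?(ltW k0)// addr_ge0.
have hd t : t \in `[s2, s1] -> is_derive t 1 (fun s => V (a s - b s))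
    (2 * dot (a t - b t - (m * dot (a t - b t) l) *: l) (- G (a t) - - G (b t))).
  by rewrite in_itv/= => /andP[_ ts1]; apply: dV; exact: le_trans s10.
have [c + E] := MVT_is_derive s21 hd.
rewrite in_itv/= => /andP[_ cs1].
have Vc := grow c cs1.
have slope : 2 * dot (a c - b c - (m * dot (a c - b c) l) *: l)
    (- G (a c) - - G (b c)) <= - k.
  rewrite (le_trans (dVle c (le_trans cs1 s10) (le_trans (ltW V1) Vc)))//.
  by rewrite mulNr lerN2 /k ler_pM2l// mulr_gt0.
have : V (a s1 - b s1) - V (a s2 - b s2) <= - (B + 1).
  rewrite E (@le_trans _ _ (- k * (s1 - s2)))//.
    by rewrite ler_wpM2r// subr_ge0.
  by rewrite /s2 opprB addrC subrK mulNr mulrC divfK// gt_eqF.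
have := Vbound s2 (le_trans s21 s10); move: V1.
move: (V _) (V _) => x y; lra.
Qed.

Notation u x := (dot (x - xi) l).

Lemma is_derive_u (w : R -> 'rV[R]_n) (dw : 'rV[R]_n) (t : R) :
  is_derive t 1 w dw -> is_derive t 1 (fun s => u (w s)) (dot dw l).
Proof.
move=> dw_; have := is_derive_dot (is_derive_dist dw_ (is_derive_cst xi t 1))
  (is_derive_cst l t 1).
by move=> k; apply: (is_derive_eq k); rewrite subr0 [dot _ 0]dotC dot0l addr0.
Qed.

Lemma norm_u_le x : `|u x| <= n%:R * `|x - xi|.
Proof.
by rewrite (le_trans (norm_dot_le _ _))// ler_piMr ?mulr_ge0// norm_unit_le1.
Qed.

Lemma u_slope x : `|x - xi| <= r -> V (x - xi) <= 0 -> ka * u x ^+ 2 <= dot (- G x) l.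
Proof.
move=> xr; rewrite /cone_form subr_le0 => /(inside xr).
by rewrite dotNl mulNr lerNr.
Qed.

Lemma lipNG M : exists2 K, 0 <= K & forall a b, `|a| <= M -> `|b| <= M ->
  `|- G a - - G b| <= K * `|a - b|.
Proof.
have [K K0 HK] := lipG M; exists K => // a b aM bM.
by rewrite -opprD normrN; exact: HK.
Qed.

Lemma is_derive_rest (t : R) : is_derive t 1 (fun=> xi) (- G xi).
Proof. by rewrite Gxi oppr0; exact: is_derive_cst. Qed.

Lemma eventually_near (w : R -> 'rV[R]_n) (e : R) : 0 < e ->
  w s @[s --> -oo%R] --> xi -> exists S, forall s, s <= S -> `|w s - xi| <= e.
Proof.
move=> e0 /cvgrPdist_le /(_ _ e0) [S [_ HS]].
exists (S - 1) => s sS; rewrite distrC; apply: HS; lra.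
Qed.

(** In the cone u = 0 would mean w = xi, which uniqueness forbids for a nonconstant orbit. A
    negative value of the nondecreasing u would bound it away from 0 at all earlier times, against
    the limit. *)
Lemma orbit_enters_cone (w : R -> 'rV[R]_n) :
  (forall s : R, is_derive s 1 w (- G (w s))) ->
  w s @[s --> -oo%R] --> xi -> ~ (exists c, forall s, w s = c) ->
  exists s0, forall s, s <= s0 -> `|w s - xi| <= r /\ 0 < u (w s).
Proof.
move=> dw wlim wc.
have [s0 ws0] := eventually_near r0 wlim.
have xr s : s <= s0 -> `|xi - xi| <= r by move=> _; rewrite subrr normr0 ltW.
have Vw := cone_backward (fun s _ => dw s) (fun s _ => is_derive_rest s) ws0 xr.
have wn s : w s <> xi.
  move=> E; apply: wc; exists xi => t.
  exact: (@ode_unique _ _ _ w (fun=> xi) s lipNG dw is_derive_rest E t).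
have un0 s : s <= s0 -> u (w s) != 0.
  move=> ss; apply/eqP => u0; apply: (wn s); apply/eqP; rewrite -subr_eq0; apply/eqP.
  apply: dot_eq0; apply/eqP; rewrite eq_le dot_ge0 andbT.
  by have := Vw s ss; rewrite /cone_form u0 expr0n/= mulr0 subr0.
have mono s t : s <= t -> t <= s0 -> u (w s) <= u (w t).
  move=> st ts.
  apply: (nondecreasing_is_derive st (fun x _ => is_derive_u (dw x))) => x.
  rewrite in_itv/= => /andP[_ xt]; have xs0 := le_trans xt ts.
  by rewrite (le_trans _ (u_slope (ws0 x xs0) (Vw x xs0)))// mulr_ge0 ?sqr_ge0// ltW.
exists s0 => s ss; split; first exact: ws0.
rewrite lt_neqAle eq_sym un0//= leNgt; apply/negP => uneg.
pose e := - u (w s) / (n%:R + 1).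
have n0 : 0 < n%:R + 1 :> R by rewrite ltr_wpDl.
have e0 : 0 < e by rewrite divr_gt0// oppr_gt0.
have [S HS] := eventually_near e0 wlim.
pose t := Num.min S s.
have tS : t <= S by rewrite ge_min lexx.
have ts : t <= s by rewrite ge_min lexx orbT.
have un : `|u (w t)| <= n%:R * e.
  by rewrite (le_trans (norm_u_le _))// ler_wpM2l// HS.
have : n%:R * e < - u (w s).
  by rewrite /e mulrCA -[ltRHS]mulr1 ltr_pM2l ?oppr_gt0// ltr_pdivrMr// mul1r ltrDl.
have := mono t s ts ss; move: un; rewrite ler_norml => /andP[].
by move: (u (w t)) (u (w s)) => x y; lra.
Qed.

(** The orbit with the larger u at [s0] is the one to be shifted: an earlier time [s1] realises the
    smaller value by the intermediate value theorem, and a shift c <= 0 keeps the orbit in the ball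
    for all s <= s0. *)
Lemma orbits_match (w w' : R -> 'rV[R]_n) (s0 : R) :
  (forall s : R, is_derive s 1 w (- G (w s))) ->
  (forall s : R, is_derive s 1 w' (- G (w' s))) ->
  w s @[s --> -oo%R] --> xi ->
  (forall s, s <= s0 -> `|w s - xi| <= r) ->
  (forall s, s <= s0 -> `|w' s - xi| <= r) ->
  0 < u (w' s0) -> u (w' s0) <= u (w s0) ->
  exists c, forall s, w' s = w (s + c).
Proof.
move=> dw dw' wlim wr wr' u'0 u'u.
have n0 : 0 < n%:R + 1 :> R by rewrite ltr_wpDl.
pose e := u (w' s0) / (n%:R + 1).
have e0 : 0 < e by rewrite divr_gt0.
have [S HS] := eventually_near e0 wlim.
pose t := Num.min S s0.
have tS : t <= S by rewrite ge_min lexx.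
have ts : t <= s0 by rewrite ge_min lexx orbT.
have ut : u (w t) <= u (w' s0).
  rewrite (le_trans (ler_norm _))// (le_trans (norm_u_le _))//.
  rewrite (@le_trans _ _ ((n%:R + 1) * e))//.
    by rewrite ler_pM ?lerDl// HS.
  by rewrite /e mulrCA mulfV ?gt_eqF// mulr1.
have cu : {within `[t, s0], continuous (fun s => u (w s))}.
  apply: derivable_within_continuous => s _.
  by have [] := is_derive_u (dw s).
have [|s1 s1I E] := IVT ts cu (v := u (w' s0)).
  by rewrite ge_min ut/= le_max u'u orbT.
rewrite in_itv/= in s1I; case/andP: s1I => ts1 s1s0.
pose c := s1 - s0.
have c0 : c <= 0 by rewrite subr_le0.
have dwc (s : R) : is_derive s 1 (fun s => w (s + c)) (- G (w (s + c))).
  by apply: (@is_derive_shiftr _ _ w).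
have wcr s : s <= s0 -> `|w (s + c) - xi| <= r by move=> ss; apply: wr; lra.
have Vd := cone_backward (fun s _ => dw' s) (fun s _ => dwc s) wr' wcr.
exists c.
apply: (@ode_unique _ _ _ w' (fun s => w (s + c)) s0 lipNG dw' dwc).
apply/eqP; rewrite -subr_eq0; apply/eqP.
apply: dot_eq0; apply/eqP; rewrite eq_le dot_ge0 andbT.
have := Vd s0 (lexx _); rewrite /cone_form.
have -> : dot (w' s0 - w (s0 + c)) l = 0.
  have -> : s0 + c = s1 by rewrite /c addrC subrK.
  by rewrite -(subrKA xi) dotDl -[xi - _]opprB dotNl E subrr.
by rewrite expr0n/= mulr0 subr0.
Qed.

Lemma orbits_unique (w w' : R -> 'rV[R]_n) :
  (forall s : R, is_derive s 1 w (- G (w s))) ->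
  w s @[s --> -oo%R] --> xi -> ~ (exists c, forall s, w s = c) ->
  (forall s : R, is_derive s 1 w' (- G (w' s))) ->
  w' s @[s --> -oo%R] --> xi -> ~ (exists c, forall s, w' s = c) ->
  exists c, forall s, w' s = w (s + c).
Proof.
move=> dw wlim wc dw' wlim' wc'.
have [s1 H1] := orbit_enters_cone dw wlim wc.
have [s2 H2] := orbit_enters_cone dw' wlim' wc'.
pose s0 := Num.min s1 s2.
have s01 : s0 <= s1 by rewrite ge_min lexx.
have s02 : s0 <= s2 by rewrite ge_min lexx orbT.
have wr s : s <= s0 -> `|w s - xi| <= r.
  by move=> ss; exact: (H1 s (le_trans ss s01)).1.
have wr' s : s <= s0 -> `|w' s - xi| <= r.
  by move=> ss; exact: (H2 s (le_trans ss s02)).1.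
have [uu|uu] := leP (u (w' s0)) (u (w s0)).
  exact: (orbits_match dw dw' wlim wr wr' (H2 s0 s02).2 uu).
have [c Hc] := orbits_match dw' dw wlim' wr' wr (H1 s0 s01).2 (ltW uu).
by exists (- c) => s; rewrite Hc subrK.
Qed.

(** * Construction of an orbit for the truncated field *)

Section Existence.
Context (M K : R).
Hypotheses (rM : `|xi| + r <= M) (K0 : 0 < K).
Notation H x := (- G (clip M x)).
Hypothesis lipH : forall a b, `|H a - H b| <= K * `|a - b|.

Lemma clip_ball x : `|x - xi| <= r -> clip M x = x.
Proof.
move=> xr; apply: clip_id; rewrite -(subrK xi x) (le_trans (ler_normD _ _))//.
by rewrite addrC (le_trans _ rM)// lerD2l.
Qed.

Lemma is_derive_truncated_rest (t : R) : is_derive t 1 (fun=> xi) (H xi).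
Proof.
by rewrite clip_ball ?subrr ?normr0 ?ltW// Gxi oppr0; exact: is_derive_cst.
Qed.

(** The forward counterpart of [cone_backward]: the decay of positive values of V makes the cone
    forward invariant, and inside it u has nonnegative slope. *)
Lemma forward_in_cone (w : R -> 'rV[R]_n) (T : R) :
  (forall t : R, is_derive t 1 w (H (w t))) ->
  (forall t, t \in `[0, T] -> `|w t - xi| <= r) ->
  V (w 0 - xi) <= 0 ->
  forall t, t \in `[0, T] -> V (w t - xi) <= 0 /\ u (w 0) <= u (w t).
Proof.
move=> dw wr V0.
have rest : 0 = - G xi by rewrite Gxi oppr0.
have xr : `|xi - xi| <= r by rewrite subrr normr0 ltW.
have dV (t : R) := is_derive_cone_form (dw t) (is_derive_truncated_rest t).
have Vle t : t \in `[0, T] -> V (w t - xi) <= 0.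
  apply: (barrier ltr01 (fun t _ => dV t) V0) => {}t tT /andP[Vt _].
  rewrite !clip_ball ?wr//.
  rewrite (le_trans (cone_form_decay (wr t tT) xr (ltW Vt)))//.
  by rewrite mulNr oppr_le0 !mulr_ge0// ltW.
move=> t tT; split; first exact: Vle.
have t0 : 0 <= t by move: tT; rewrite in_itv/= => /andP[].
apply: (nondecreasing_is_derive t0 (fun s _ => is_derive_u (dw s))) => s st.
have sT : s \in `[0, T].
  move: st tT; rewrite !in_itv/= => /andP[-> st] /andP[_ tT].
  exact: le_trans tT.
rewrite clip_ball ?wr// (le_trans _ (u_slope (wr s sT) (Vle s sT)))//.
by rewrite mulr_ge0 ?sqr_ge0// ltW.
Qed.

Lemma cone_form_axis (e : R) : V (xi + e *: l - xi) <= 0.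
Proof.
rewrite addrAC subrr add0r /cone_form !dotZl dotZr l1 !mulr1 -expr2 subr_le0.
by rewrite ler_peMl ?sqr_ge0.
Qed.

Lemma u_axis (e : R) : u (xi + e *: l) = e.
Proof. by rewrite addrAC subrr add0r dotZl l1 mulr1. Qed.

Lemma norm_axis_le (e : R) : 0 <= e -> `|xi + e *: l - xi| <= e.
Proof.
by move=> e0; rewrite addrAC subrr add0r normrZ ger0_norm// ler_piMr// norm_unit_le1.
Qed.

(* The coordinate [u] grows at least at the rate [ka * e ^ 2]. *)
Lemma exit_ball (w : R -> 'rV[R]_n) (e : R) : 0 < e -> e < r ->
  (forall t : R, is_derive t 1 w (H (w t))) -> w 0 = xi + e *: l ->
  exists2 T, 0 <= T & `|w T - xi| = r /\
    forall t, t \in `[0, T] -> `|w t - xi| <= r.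
Proof.
move=> e0 er dw w0.
have cw : continuous (fun t => `|w t - xi|).
  move=> t; apply: cvg_norm; apply: cvgB; last exact: cvg_cst.
  exact: (is_derive_continuous (dw t)).
have w0r : `|w 0 - xi| < r by rewrite w0 (le_lt_trans (norm_axis_le (ltW e0))).
have [t1 t10 wt1] : exists2 t, 0 <= t & r <= `|w t - xi|.
  apply: contrapT => noexit.
  have wr t : 0 <= t -> `|w t - xi| <= r.
    move=> t0; rewrite leNgt; apply/negP => rt; apply: noexit.
    by exists t => //; exact: ltW.
  (* By this time u would have gained n r + 1, more than the ball allows. *)
  pose T := (n%:R * r + 1) / (ka * e ^+ 2).
  have nr : 0 <= n%:R * r by rewrite mulr_ge0// ltW.
  have ke : 0 < ka * e ^+ 2 by rewrite mulr_gt0// exprn_gt0.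
  have T0 : 0 <= T by rewrite divr_ge0 ?(ltW ke)// addr_ge0.
  have wrT t : t \in `[0, T] -> `|w t - xi| <= r.
    by rewrite in_itv/= => /andP[t0 _]; exact: wr.
  have V0 : V (w 0 - xi) <= 0 by rewrite w0 cone_form_axis.
  have cone := forward_in_cone dw wrT V0.
  have [c cT E] := MVT_is_derive T0 (fun s _ => is_derive_u (dw s)).
  have [Vc uc] := cone c cT.
  rewrite clip_ball ?wrT// w0 u_axis subr0 in E.
  have slope : ka * e ^+ 2 <= dot (- G (w c)) l.
    rewrite (le_trans _ (u_slope (wrT c cT) Vc))// ler_pM2l//.
    move: uc; rewrite w0 u_axis => uc.
    by rewrite ler_sqr ?nnegrE// ?(ltW e0)// (le_trans (ltW e0)).
  have : ka * e ^+ 2 * T <= u (w T) - e by rewrite E ler_wpM2r.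
  rewrite /T mulrC divfK ?gt_eqF// -/T.
  have := le_trans (ler_norm _) (norm_u_le (w T)).
  have : n%:R * `|w T - xi| <= n%:R * r by rewrite ler_wpM2l// wr.
  by move: (u (w T)) (n%:R * `|_|) (n%:R * r) => x y z; lra.
have [T T0 [wT wr]] := first_hitting cw t10 w0r wt1.
exists T => //; split=> // t; rewrite in_itv/= => /andP[t0 tT]; exact: wr.
Qed.

(* By Gronwall's inequality, leaving the ball from distance [e] takes a time
   that tends to infinity as [e] tends to 0. *)
Lemma approximate_orbit (k : nat) : exists z : R -> 'rV[R]_n,
  [/\ forall t : R, is_derive t 1 z (H (z t)), `|z 0 - xi| = r &
   forall t, t \in `[- k%:R, 0] ->
     [/\ `|z t - xi| <= r, V (z t - xi) <= 0 & 0 <= u (z t)]].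
Proof.
pose L := 2 * n%:R * K.
have L0 : 0 <= L by rewrite !mulr_ge0// ltW.
pose E := expR (L * k%:R).
have E1 : 1 <= E by rewrite -expR0 ler_expR mulr_ge0.
have E0 : 0 < E by rewrite expR_gt0.
pose N : R := n%:R + 1.
have N0 : 0 < N by rewrite ltr_wpDl.
have N1 : 1 <= N by rewrite lerDr.
(* [E] bounds the growth of the squared distance up to time k, and E n e^2 = r^2 n / (4 N^2 E) <
   r^2, so the exit happens later than k. *)
pose e := r / (2 * N * E).
have NE0 : 0 < 2 * N * E by rewrite !mulr_gt0.
have NE2 : 2 <= 2 * N * E by rewrite -mulrA ler_peMr// mulr_ege1.
have e0 : 0 < e by rewrite divr_gt0.
have er2 : e <= r / 2 by rewrite ler_pM2l// lef_pV2 ?posrE.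
have er : e < r by lra.
have [w [w0 dw]] := picard (G := fun x => H x) (xi + e *: l) K0 lipH.
have [T T0 [wT wr]] := exit_ball e0 er dw w0.
have kT : k%:R < T.
  rewrite ltNge; apply/negP => Tk.
  have := gronwall_dist (ltW K0) (fun s (_ : s \in `[0, k%:R]) => dw s)
     (fun s _ => is_derive_truncated_rest s) (fun s _ => lipH (w s) xi)
     (s := 0) (t := T).
  rewrite !in_itv/= lexx T0 Tk ler0n => /(_ isT isT).
  rewrite subr0 ger0_norm// -/L => gr.
  have gr1 : r ^+ 2 <= E * (n%:R * e ^+ 2).
    rewrite -wT (le_trans (sqr_norm_le_dot _))// (le_trans gr)//.
    rewrite ler_pM ?expR_ge0 ?dot_ge0//.
      by rewrite ler_expR ler_wpM2l.
    rewrite (le_trans (dot_le_sqr_norm _))// ler_wpM2l//.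
    by rewrite ler_sqr ?nnegrE ?(ltW e0)// w0 norm_axis_le// ltW.
  have : E * (n%:R * e ^+ 2) < r ^+ 2.
    have -> : E * (n%:R * e ^+ 2) = r ^+ 2 * (n%:R / (4 * N ^+ 2 * E)).
      by rewrite /e; field; rewrite !gt_eqF.
    rewrite -[ltRHS]mulr1 ltr_pM2l ?exprn_gt0//.
    rewrite ltr_pdivrMr ?mulr_gt0 ?exprn_gt0// mul1r.
    have : N <= N ^+ 2 * E.
      by rewrite expr2 -mulrA ler_peMr ?(ltW N0)// mulr_ege1.
    rewrite -mulrA; have : n%:R < N by rewrite ltrDl.
    by move: (N ^+ 2 * E) => x; move: (n%:R : R) (N) N0 => p q; lra.
  by rewrite ltNge gr1.
(* Time is shifted so that the exit occurs at time 0. *)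
exists (fun s => w (s + T)); split; [|by rewrite add0r|].
  by move=> t; apply: (@is_derive_shiftr _ _ w).
move=> t; rewrite in_itv/= => /andP[kt t0].
have tT : t + T \in `[0, T] by rewrite in_itv/=; apply/andP; split; lra.
have V0 : V (w 0 - xi) <= 0 by rewrite w0 cone_form_axis.
have [Vt ut] := forward_in_cone dw wr V0 tT.
split; [exact: wr | exact: Vt |].
by rewrite (le_trans _ ut)// w0 u_axis ltW.
Qed.

(** Compactness is used only for the exit points on a sphere: Gronwall carries closeness at time 0
    to any fixed t <= 0, and the three conditions there are closed, so no compactness of families of
    functions is involved. *)
Lemma backward_orbit : exists w : R -> 'rV[R]_n,
  [/\ forall t : R, is_derive t 1 w (H (w t)), `|w 0 - xi| = r &
   forall t, t <= 0 ->
     [/\ `|w t - xi| <= r, V (w t - xi) <= 0 & 0 <= u (w t)]].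
Proof.
have [z Hz] := choice approximate_orbit.
pose A := [set x : 'rV[R]_n | `|x - xi| = r].
have cA : compact A.
  apply: bounded_closed_compact.
    exists (`|xi| + r); split; first exact: num_real.
    move=> N MN x /= xr; rewrite -(subrK xi x) (le_trans (ler_normD _ _))//.
    by rewrite xr addrC ltW.
  have -> : A = (fun x : 'rV[R]_n => `|x - xi|) @^-1` [set r] by [].
  apply: closed_comp; last exact: closed_eq.
  by move=> x _; exact: continuous_dist.
have FA : ((fun k => z k 0) @ \oo) A.
  by exists 0%N => // k _; have [] := Hz k.
have [p [Ap clp]] := cA ((fun k => z k 0) @ \oo) _ FA.
have near_p e (N : nat) : 0 < e -> exists k, (N <= k)%N /\ `|p - z k 0| < e.
  move=> e0.
  have F1 : ((fun k => z k 0) @ \oo) [set x | exists k, (N <= k)%N /\ x = z k 0].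
    by exists N => // k /= Nk; exists k.
  have [x [[k [Nk ->]] xe]] := clp _ _ F1 (nbhsx_ballx p e e0).
  by exists k; split=> //; move: xe; rewrite -ball_normE.
have [w [w0 dw]] := picard (G := fun x => H x) p K0 lipH.
exists w; split=> //; first by rewrite w0.
move=> t t0.
have close e : 0 < e -> exists x, `|w t - x| < e /\
    [/\ `|x - xi| <= r, V (x - xi) <= 0 & 0 <= u x].
  move=> e0.
  (* Contains the Gronwall factor and the norm-comparison factor [n]; the added 1 gives C >= 1, so
     that C (e/C)^2 <= e^2. *)
  pose C := expR (2 * n%:R * K * `|t - 0|) * n%:R + 1.
  have C0 : 0 < C by rewrite ltr_wpDl// mulr_ge0// expR_ge0.
  have C1 : 1 <= C by rewrite lerDr mulr_ge0// expR_ge0.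
  have [k [Nk pk]] := near_p (e / C) (Num.truncn (- t)).+1 (divr_gt0 e0 C0).
  exists (z k t); split; last first.
    have [_ _] := Hz k; apply; rewrite in_itv/= t0 andbT lerNl.
    have := truncnS_gt (- t).
    move=> /ltW /le_trans; apply; by rewrite ler_nat.
  have [dz _ _] := Hz k.
  have := gronwall_dist (ltW K0) (fun s (_ : s \in `[t, 0]) => dw s)
     (fun s _ => dz s) (fun s _ => lipH (w s) (z k s)) (s := 0) (t := t).
  rewrite !in_itv/= !lexx t0 => /(_ isT isT) gr.
  rewrite -(ltr_sqr (normr_ge0 _)) ?nnegrE ?(ltW e0)//; last first.
  rewrite (le_lt_trans (sqr_norm_le_dot _))// (le_lt_trans gr)// w0.
  rewrite (@le_lt_trans _ _ (C * `|p - z k 0| ^+ 2))//.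
    rewrite (@le_trans _ _ (expR (2 * n%:R * K * `|t - 0|) * (n%:R * `|p - z k 0| ^+ 2)))//.
      by rewrite ler_wpM2l ?expR_ge0// dot_le_sqr_norm.
    by rewrite mulrA ler_wpM2r ?sqr_ge0// lerDl.
  rewrite (@lt_le_trans _ _ (C * (e / C) ^+ 2))//.
    by rewrite ltr_pM2l// ltr_sqr ?nnegrE// ltW// divr_gt0.
  have -> : C * (e / C) ^+ 2 = e ^+ 2 / C by field; rewrite gt_eqF.
  by rewrite ler_pdivrMr// ler_peMr// sqr_ge0.
have cd (c : 'rV[R]_n) : continuous (fun x : 'rV[R]_n => dot (x - xi) c).
  apply: continuous_dot; last by move=> x; exact: cst_continuous.
  exact: continuous_subr.
have cdd : continuous (fun x : 'rV[R]_n => dot (x - xi) (x - xi)).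
  by apply: continuous_dot; exact: continuous_subr.
split.
- apply: (@continuous_le_closure _ _ (fun x => `|x - xi|) (fun=> r)).
  + exact: continuous_dist.
  + exact: cst_continuous.
  + by move=> e e0; have [x [xe [xr _ _]]] := close e e0; exists x.
- rewrite subr_le0.
  apply: (@continuous_le_closure _ _ (fun x => dot (x - xi) (x - xi))
    (fun x => m * u x ^+ 2)) => //.
  + exact: continuous_scale_sqr.
  + move=> e e0; have [x [xe [_ xV _]]] := close e e0.
    by exists x; split=> //; rewrite -subr_le0.
- apply: (@continuous_le_closure _ _ (fun=> 0) (fun x => u x)) => //.
  + exact: cst_continuous.
  + by move=> e e0; have [x [xe [_ _ xu]]] := close e e0; exists x.
Qed.

End Existence.

Lemma orbit_exists (a0 c0 : R) : 0 <= a0 -> 0 < c0 ->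
  (forall x, c0 * dot x x - a0 <= dot (G x) x) ->
  exists w : R -> 'rV[R]_n,
  [/\ forall s : R, is_derive s 1 w (- G (w s)),
      w s @[s --> -oo%R] --> xi & ~ (exists c, forall s, w s = c)].
Proof.
move=> a00 c00 coer.
have xr0 : 0 <= `|xi| + r by rewrite addr_ge0 ?(ltW r0).
(* The first summand yields [a0 <= c0 * rho], the second puts the starting point in the invariant
   ball. [M] is then at least 1, [rho + 1] and |xi| + r, so the truncation never acts along the
   orbit. *)
pose rho := a0 / c0 + n%:R * (`|xi| + r) ^+ 2.
have ac0 : 0 <= a0 / c0 by rewrite divr_ge0// ltW.
have nr0 : 0 <= n%:R * (`|xi| + r) ^+ 2 by rewrite mulr_ge0// sqr_ge0.
have rho0 : 0 <= rho by rewrite addr_ge0.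
pose M := rho + 1 + (`|xi| + r).
have rM : `|xi| + r <= M by rewrite lerDr addr_ge0.
have M1 : rho + 1 <= M by rewrite lerDl.
have M0 : 0 <= M by rewrite (le_trans xr0).
have rhoM : rho + 1 <= M ^+ 2.
  have M1' : 1 <= M by rewrite (le_trans _ M1)// lerDr.
  by rewrite (le_trans M1)// expr2 ler_peMr.
have [K K0 lipH] := truncated_lipschitz M0 lipG.
have [w [dH w0 wneg]] := backward_orbit rM K0 lipH.
have arho : a0 <= c0 * rho by rewrite mulrDr mulrC divfK ?gt_eqF// lerDl mulr_ge0// ltW.
have ball x : `|x - xi| <= r -> `|x| <= `|xi| + r.
  move=> xr; rewrite -(subrK xi x) (le_trans (ler_normD _ _))//.
  by rewrite addrC lerD2l.
have w0rho : dot (w 0) (w 0) <= rho.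
  rewrite (le_trans (dot_le_sqr_norm _))// (@le_trans _ _ (n%:R * (`|xi| + r) ^+ 2))//.
    by rewrite ler_wpM2l// ler_sqr ?nnegrE// ball// w0.
  by rewrite lerDr.
have wM t : `|w t| <= M.
  have [t0|t0] := leP t 0.
    by rewrite (le_trans _ rM)// ball//; have [] := wneg t t0.
  rewrite -(ler_sqr (normr_ge0 _)) ?nnegrE// (le_trans (sqr_norm_le_dot _))//.
  rewrite (le_trans (forward_invariant_ball c00 coer arho rhoM M0 dH w0rho (ltW t0)))//.
  by rewrite (le_trans _ rhoM)// lerDl.
have dw (s : R) : is_derive s 1 w (- G (w s)).
  by have := dH s; rewrite clip_id.
have slope s : s <= 0 -> ka * u (w s) ^+ 2 <= dot (- G (w s)) l.
  by move=> s0; have [wr wV _] := wneg s s0; exact: u_slope.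
(* If u stayed above [eta] for all negative times, its slope would be at least ka eta^2 and u would
   become negative far enough back. *)
have small eta : 0 < eta -> exists2 S, S <= 0 & u (w S) < eta.
  move=> eta0; apply: contrapT => nS.
  have large s : s <= 0 -> eta <= u (w s).
    by move=> s0; rewrite leNgt; apply/negP => us; apply: nS; exists s.
  have ke : 0 < ka * eta ^+ 2 by rewrite mulr_gt0// exprn_gt0.
  pose s := - ((n%:R * r + 1) / (ka * eta ^+ 2)).
  have nr : 0 <= n%:R * r by rewrite mulr_ge0// ltW.
  have s0 : s <= 0 by rewrite oppr_le0 divr_ge0 ?(ltW ke)// addr_ge0.
  have [c + E] := MVT_is_derive s0 (fun t _ => is_derive_u (dw t)).
  rewrite in_itv/= => /andP[_ cle0].
  have : ka * eta ^+ 2 * (0 - s) <= u (w 0) - u (w s).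
    rewrite E ler_wpM2r ?subr_ge0// (le_trans _ (slope c cle0))// ler_pM2l//.
    by rewrite ler_sqr ?nnegrE ?(ltW eta0) ?large// (le_trans (ltW eta0))// large.
  rewrite sub0r /s opprK mulrC divfK ?gt_eqF// -/s.
  have := le_trans (ler_norm _) (norm_u_le (w 0)); rewrite w0.
  have := large s s0.
  by move: (u (w 0)) (u (w s)) (n%:R * r) => x y z; lra.
have mono s t : s <= t -> t <= 0 -> u (w s) <= u (w t).
  move=> st ts.
  apply: (nondecreasing_is_derive st (fun x _ => is_derive_u (dw x))) => x.
  rewrite in_itv/= => /andP[_ xt].
  by rewrite (le_trans _ (slope x (le_trans xt ts)))// mulr_ge0 ?sqr_ge0// ltW.
have m0 : 0 < m by rewrite (lt_le_trans ltr01).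
have wlim : w s @[s --> -oo%R] --> xi.
  apply/cvgrPdist_lt => e e0.
  (* In the cone |w - xi|^2 <= m u^2, and m (e/m)^2 <= e^2 because m >= 1. *)
  have [S S0 uS] := small (e / m) (divr_gt0 e0 m0).
  exists S; split; first exact: num_real.
  move=> s /ltW sS; rewrite distrC.
  have s0 := le_trans sS S0.
  have [_ wV us0] := wneg s s0.
  rewrite -(ltr_sqr (normr_ge0 _)) ?nnegrE ?(ltW e0)//.
  rewrite (le_lt_trans (sqr_norm_le_dot _))//.
  rewrite (@le_lt_trans _ _ (m * u (w s) ^+ 2))//; first by rewrite -subr_le0.
  rewrite (@lt_le_trans _ _ (m * (e / m) ^+ 2))//.
    rewrite ltr_pM2l// ltr_sqr ?nnegrE//; last by rewrite ltW// divr_gt0.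
    exact: le_lt_trans (mono s S sS S0) uS.
  have -> : m * (e / m) ^+ 2 = e ^+ 2 / m by field; rewrite gt_eqF.
  by rewrite ler_pdivrMr// ler_peMr// sqr_ge0.
exists w; split=> // -[c wc].
(* A constant orbit would stay at distance [r] from [xi], its distance at time 0, contradicting the
   limit. *)
have r2 : 0 < r / 2 by rewrite divr_gt0.
have [S HS] := eventually_near r2 wlim.
have wS : `|w S - xi| = r by rewrite wc -(wc 0).
have := HS S (lexx _); rewrite wS => rr.
by lra.
Qed.

End Orbits.

Lemma grad_lipschitz_ball {R : realType} {n : nat} (g : 'rV[R]_n -> R) (M : R) :
  Ck 2 g -> exists2 K, 0 <= K & forall a b, `|a| <= M -> `|b| <= M ->
    `|grad g a - grad g b| <= K * `|a - b|.
Proof.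
move=> cg.
have /choice [K HK] : forall i, exists K, 0 <= K /\ forall a b, `|a| <= M ->
    `|b| <= M -> `|partial i g a - partial i g b| <= K * `|a - b|.
  by move=> i; have [K ? ?] := Ck1_lipschitz_ball M (Ck_partial i cg); exists K.
have K0 : 0 <= \sum_i K i by apply: sumr_ge0 => i _; exact: (HK i).1.
exists (\sum_i K i) => // a b aM bM.
apply: norm_le_coord => [|i]; first by rewrite mulr_ge0.
rewrite !mxE (le_trans ((HK i).2 a b aM bM))// ler_wpM2r//.
by rewrite (bigD1 i)//= lerDl; apply: sumr_ge0 => j _; exact: (HK j).1.
Qed.

Unset Implicit Arguments.

Theorem lemma2p5 (R : realType) (n : nat) (T : R) (f : R -> 'rV[R]_n -> R)
    (a0 c0 : R)
    (hT : 0 < T)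
    (hf : CkT T 3 f)
    (ha0 : 0 <= a0) (hc0 : 0 < c0)
    (hcoer : forall (t : R) (x : 'rV[R]_n), t \in `[0, T] ->
       c0 * dot x x - a0 <= dot (grad (f t) x) x)
    (hZ : forall (tau : R) (xi : 'rV[R]_n), Zset T f (tau, xi) ->
       possemidef (hessian (f tau) xi) ->
       exists l : 'rV[R]_n,
         [/\ l <> 0,
             (* [kermx] is the kernel acting on row vectors, hence the
                transpose *)
             (kermx (hessian (f tau) xi)^T == l)%MS
           & third_form (f tau) xi l <> 0])
    (tau : R) (xi : 'rV[R]_n)
    (hin : Zset T f (tau, xi))
    (hpsd : possemidef (hessian (f tau) xi)) :
  (exists w : R -> 'rV[R]_n, nonconstant_orbit_from (f tau) xi w) /\
  (forall w w' : R -> 'rV[R]_n,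
     nonconstant_orbit_from (f tau) xi w ->
     nonconstant_orbit_from (f tau) xi w' ->
     exists c : R, forall s : R, w' s = w (s + c)).
Proof.
have [tauT /= g0 _] := hin.
have cg : Ck 3 (f tau) := CkT_slice tauT hf.
have [l0 [l00 kerl third]] := hZ tau xi hin hpsd.
have [l [m [r [mu [ka [l1 m1 [r0 mu0 ka0] outside inside]]]]]] :=
  saddle_node_cone cg g0 hpsd l00 kerl third.
have lipG M := grad_lipschitz_ball M (CkS cg).
have coer x := hcoer tau x tauT.
split.
  have [w [dw wlim wc]] :=
    orbit_exists g0 l1 m1 r0 mu0 ka0 outside inside lipG ha0 hc0 coer.
  by exists w.
move=> w w' [dw wlim wc] [dw' wlim' wc'].
exact: (orbits_unique g0 l1 m1 r0 mu0 ka0 outside inside lipG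
  dw wlim wc dw' wlim' wc').
Qed.
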